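(* Let $\beta=1$ and let $X_1,X_2,\ldots$ be i.i.d. with distribution $F\in\mathcal{G}_\alpha$, where $\alpha>0$. Then, as $k\to\infty$, $$T_k^*=\frac{T_k}{\sum_{j=1}^{k-1}[1-F(\overline{Y}_j)]^{-1}}\to1\quad\text{almost surely}.$$
   Context: Selection rule. $X_1,X_2,\ldots$ are i.i.d. with a common absolutely continuous distribution function $F$ such that $1-F(x)>0$ for all $x<\infty$. For fixed $\beta\ge1$, set $T_1=1$, $Y_1=X_1$, and inductively $T_{k+1}=\inf\{i>T_k: X_i>\beta\overline{Y}_k\}$, $Y_{k+1}=X_{T_{k+1}}$, where $\overline{Y}_k=\frac1k\sum_{j=1}^kY_j$. Thus $T_k$ is the number of observations inspected until the $k$th item is retained. VM distribution. Let $x_F=\sup\{x:F(x)<1\}$. $F$, belonging to the domain of attraction of the Gumbel extreme value distribution $\exp\{-e^{-x}\}$, is a Von Mises function (VM) if there exist $x_0$ and $r>0$ such that for $x_0<x<x_F$, $1-F(x)=r\exp\{-\int_{x_0}^x[1/f_A(u)]\,du\}=:e^{-H(x)}$, where $f_A>0$ on $(x_0,x_F)$, $f_A$ is absolutely continuous on $(x_0,x_F)$ with derivative $f_A'$, and $\lim_{u\nearrow x_F}f_A'(u)=0$. Only VM distributions with $x_F=\infty$ are considered. Class $\mathcal{G}_\alpha$ ($\alpha>0$). $F\in\mathcal{G}_\alpha$ (generalized stretched exponential) if $F$ is VM and $H(x)=x^\alpha+h(x)$ for $x>x_0$, where $h''$ exists, $\lim_{x\to\infty}h(x)/x^\alpha=0$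 and $\lim_{x\to\infty}h'(x)/x^{\alpha-1}=0$. *)

(* Defs.v *)
From HB Require Import structures.
From mathcomp Require Import all_boot all_order all_algebra.
From mathcomp Require Import all_classical all_reals all_analysis.

Set Implicit Arguments.
Unset Strict Implicit.
Unset Printing Implicit Defensive.

Import Order.TTheory GRing.Theory Num.Theory.
Import numFieldNormedType.Exports.

Local Open Scope classical_set_scope.
Local Open Scope ring_scope.

(** ** Selection rule

    A realisation of the observations is a sequence [x : nat -> R] read from
    index 1 on; [x 0] is never inspected.  A retention time is an [option nat],
    [None] standing for the infimum of the empty set, i.e. [+oo]. *)

Definition first_exceed (R : realType) (x : nat -> R) (t : nat) (y : R)
    : option nat :=
  match pselect (exists i, (t < i)%N && (y < x i)) with
  | left ex => Some (ex_minn ex)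
  | right _ => None
  end.

Definition mean (R : realType) (ys : seq R) : R :=
  (\sum_(y <- ys) y) / (size ys)%:R.

(** [retention beta x k = (T_{k+1}, [:: Y_1; ...; Y_{k+1}])].  Once some [T_k]
    is infinite all later ones are, and the [Y]s from there on are junk. *)
Fixpoint retention (R : realType) (beta : R) (x : nat -> R) (k : nat)
    : option nat * seq R :=
  match k with
  | 0%N => (Some 1%N, [:: x 1%N])
  | k'.+1 =>
      let (t, ys) := retention beta x k' in
      let t' := obind (fun i => first_exceed x i (beta * mean ys)) t in
      (t', rcons ys (oapp x 0 t'))
  end.

(** [T_k] and the mean of [Y_1, ..., Y_k], meaningful for [k >= 1]. *)
Definition ret_time (R : realType) (beta : R) (x : nat -> R) (k : nat)
    : \bar R :=
  oapp (fun n : nat => (n%:R)%:E) +oo%E (retention beta x k.-1).1.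

Definition ret_mean (R : realType) (beta : R) (x : nat -> R) (k : nat) : R :=
  mean (retention beta x k.-1).2.

(** [T_k^*]; since it is [+oo] (for [k >= 2]) whenever [T_k] is, its convergence
    to 1 entails that every [T_k] is finite. *)
Definition ret_ratio (R : realType) (F : R -> R) (beta : R) (x : nat -> R)
    (k : nat) : \bar R :=
  (ret_time beta x k *
   ((\sum_(1 <= j < k) (1 - F (ret_mean beta x j))^-1)^-1)%:E)%E.

(** ** Independent identically distributed observations *)

Definition mutually_independent d (T : measurableType d) (R : realType)
    (P : probability T R) (X : nat -> {RV P >-> R}) : Prop :=
  forall (s : seq nat) (B : nat -> set R),
    uniq s -> (forall i, measurable (B i)) ->
    P (\bigcap_(i in [set` s]) (X i @^-1` B i)) =
    (\prod_(i <- s) P (X i @^-1` B i))%E.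

Definition iid_with_cdf d (T : measurableType d) (R : realType)
    (P : probability T R) (X : nat -> {RV P >-> R}) (F : R -> R) : Prop :=
  mutually_independent X /\ forall i x, cdf (X i) x = (F x)%:E.

(** ** Von Mises functions and generalized stretched exponentials *)

Definition absolutely_continuous (R : realType) (D : interval R) (f : R -> R)
    : Prop :=
  forall e : R, 0 < e -> exists2 d : R, 0 < d &
    forall (n : nat) (u v : 'I_n -> R),
      (forall i, [/\ u i \in D, v i \in D & u i <= v i]) ->
      trivIset setT (fun i => `]u i, v i[%classic) ->
      \sum_(i < n) (v i - u i) < d ->
      \sum_(i < n) `|f (v i) - f (u i)| < e.

Definition right_endpoint (R : realType) (F : R -> R) : \bar R :=
  ereal_sup [set x%:E | x in [set x : R | F x < 1]].

Definition gumbel_attracted (R : realType) (F : R -> R) : Prop :=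
  exists a b : nat -> R, (forall n, 0 < a n) /\
    forall x : R,
      (fun n => F (a n * x + b n) ^+ n) @ \oo --> expR (- expR (- x)).

(** The Von Mises property with right endpoint [+oo] and threshold [x0].  [fA']
    is the derivative of the absolutely continuous function [fA], which exists
    only almost everywhere. *)
Definition von_mises_from (R : realType) (F : R -> R) (x0 : R) : Prop :=
  [/\ gumbel_attracted F,
      right_endpoint F = +oo%E &
      exists (r : R) (fA fA' : R -> R),
        [/\ 0 < r,
            forall x, x0 < x -> 0 < fA x,
            forall x, x0 < x ->
              (@lebesgue_measure R).-integrable `]x0, x]
                (EFin \o (fun u => (fA u)^-1)) /\
              1 - F x =
                r * expR (- \int[@lebesgue_measure R]_(u in `]x0, x])
                              (fA u)^-1),
            absolutely_continuous `]x0, +oo[ fA &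
            {ae @lebesgue_measure R,
               forall u, x0 < u -> is_derive u 1 fA (fA' u)} /\
            fA' u @[u --> +oo] --> 0]].

(** [H], where [1 - F x = exp (- H x)]. *)
Definition hazard (R : realType) (F : R -> R) (x : R) : R := - ln (1 - F x).

(** [0 <= x0] loses nothing, as the threshold may always be enlarged; it makes
    [x `^ alpha] the usual real power for every [x > x0]. *)
Definition stretched_exponential (R : realType) (alpha : R) (F : R -> R)
    : Prop :=
  exists x0 : R, [/\ 0 <= x0, von_mises_from F x0 &
    exists h : R -> R,
      [/\ forall x, x0 < x -> hazard F x = x `^ alpha + h x,
          forall x, x0 < x -> derivable h x 1 /\ derivable (derive1 h) x 1,
          h x / x `^ alpha @[x --> +oo] --> 0 &
          derive1 h x / x `^ (alpha - 1) @[x --> +oo] --> 0]].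

(* Main.v *)
Require Import Defs.
From HB Require Import structures.
From mathcomp Require Import all_boot all_order all_algebra.
From mathcomp Require Import all_classical all_reals all_analysis.
From mathcomp Require Import measurable_realfun.
From mathcomp Require Import ring lra zify.

Set Implicit Arguments.
Unset Strict Implicit.
Unset Printing Implicit Defensive.

Import Order.TTheory GRing.Theory Num.Theory.
Import numFieldNormedType.Exports.

Local Open Scope classical_set_scope.
Local Open Scope ring_scope.

(* Index time by the observations.  Let k be the number of values retained so
   far, m their mean, w = 1/(1 - F m), and let S be the sum of the weights w at
   the first k means.  Given the past, an observation is retained with
   probability 1/w, so the sum of (w [retained] - 1)/S is a martingale; at a
   retention time Kronecker's lemma turns its convergence into the claim.  It
   converges if the sum of (w/S)^2 over the retained values is finite.

   Regularity of F gives this.  By Borel-Cantelli the hazard H of a retained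
   value exceeds H m by at most 2 ln (k + 1), up to finitely many exceptions, so
   that one retention raises the hazard of the mean by (log k)^O(1) / k, which is
   eventually below k^(-3/4) / 2.  Hence S/w grows at least like k^(3/4). *)

(** * The past of the observations and the next observation *)

(** Indexing by observations keeps the filtration deterministic: only one-step statements about the
    next observation given the past are needed, and no law of a waiting time. Two obstacles shape
    the rest. First, the sum of [(weight / wsum) ^+ 2] over the retained values is bounded only
    almost surely, by a constant depending on the path, whereas convergence of the martingale is
    obtained from a bound on second moments. The coefficients are therefore cut off, by an indicator
    known in advance, where their squares exceed [N%:R * rgap (cnt i)]; on almost every path some
    [N] makes the cut-off ineffective from some time on, and countably many [N] cost one null set.
    Second, sums over the retained values run over random times. Their bounds are written as
    differences [psi k - psi k.+1] in the count [k], which telescope along every path: [gap] serves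
    Borel-Cantelli, [rgap] the second moments. The exponent 3/4 could be any number strictly between
    1/2 and 1: above 1/2 the squares are summable, below 1 there is room for the logarithms. *)

Section past.
Context d (Omega : measurableType d) (R : realType) (P : probability Omega R).
Variable X : nat -> {RV P >-> R}.

Definition cylinder (B : nat -> set R) (n : nat) : set Omega :=
  [set w | forall i, (i <= n)%N -> B i (X i w)].

Definition cylinders (n : nat) : set (set Omega) :=
  [set A | exists2 B, (forall i, measurable (B i)) & A = cylinder B n].

(** The points are still those of [Omega]; only the sigma-algebra is smaller. Being determined by
    the observations up to [n] is thus measurability of the same function on another type. *)
Definition past (n : nat) := g_sigma_algebraType (cylinders n).

Definition adapted d' (T' : measurableType d') (n : nat) (f : Omega -> T') :=
  measurable_fun setT (f : past n -> T').

Lemma measurable_RV (i : nat) (B : set R) :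
  measurable B -> measurable (X i @^-1` B).
Proof. by move=> mB; rewrite -[_ @^-1` _]setTI; exact: measurable_funP. Qed.

Lemma cylinderE B n :
  cylinder B n = \bigcap_(i in [set` iota 0 n.+1]) X i @^-1` B i.
Proof.
have iE i : (i \in iota 0 n.+1) = (i <= n)%N by rewrite mem_iota add0n ltnS.
apply/seteqP; split => w h i ni; apply: h; first by rewrite -iE.
by rewrite /mkset iE.
Qed.

Lemma cylinders_measurable n : cylinders n `<=` measurable.
Proof.
move=> A [B mB ->]; rewrite cylinderE.
apply: bigcap_measurable; first by exists 0%N.
by move=> i _; exact: measurable_RV.
Qed.

Lemma past_measurable n (A : set Omega) :
  measurable (A : set (past n)) -> measurable A.
Proof.
apply: (@smallest_sub _ _ (cylinders n)).
  exact: sigma_algebra_measurable.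
exact: cylinders_measurable.
Qed.

Lemma adapted_measurable d' (T' : measurableType d') n (f : Omega -> T') :
  adapted n f -> measurable_fun setT f.
Proof. by move=> mf _ B mB; apply: (@past_measurable n); exact: mf. Qed.

Lemma adaptedS d' (T' : measurableType d') n m (f : Omega -> T') :
  (n <= m)%N -> adapted n f -> adapted m f.
Proof.
move=> nm mf _ B mB; have := mf measurableT B mB.
apply: (@smallest_sub _ _ (cylinders n)).
  exact: smallest_sigma_algebra.
move=> A [C mC ->]; apply: sub_sigma_algebra.
exists (fun i => if (i <= n)%N then C i else setT).
  by move=> i; case: ifP.
apply/seteqP; split => w h i im; first by case: ifP => // /h.
by have := h i (leq_trans im nm); rewrite im.
Qed.

Lemma adapted_X n i : (i <= n)%N -> adapted n (X i).
Proof.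
move=> ni _ B mB; rewrite setTI; apply: sub_sigma_algebra.
exists (fun j => if j == i then B else setT); first by move=> j; case: ifP.
apply/seteqP; split => w h; first by move=> j _; case: eqP => // ->.
by have := h i ni; rewrite eqxx.
Qed.

Hypothesis X_ind : mutually_independent X.

Lemma cylinders_indep n (A : set Omega) (B : set R) :
  cylinders n A -> measurable B ->
  P (A `&` X n.+1 @^-1` B) = (P A * P (X n.+1 @^-1` B))%E.
Proof.
move=> [C mC ->] mB.
pose C' i := if (i <= n)%N then C i else B.
have mC' i : measurable (C' i) by rewrite /C'; case: ifP.
have -> : cylinder C n `&` X n.+1 @^-1` B = cylinder C' n.+1.
  apply/seteqP; split => w.
    move=> [h hB] i; rewrite /C' leq_eqVlt => /predU1P[->|].
      by rewrite ltnn.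
    by rewrite ltnS => ni; rewrite ni; exact: h.
  move=> h; split; last by have := h n.+1 (leqnn _); rewrite /C' ltnn.
  by move=> i ni; have := h i (leqW ni); rewrite /C' ni.
rewrite !cylinderE !X_ind ?iota_uniq// -(addn1 n.+1) iotaD big_cat add0n.
rewrite big_seq1 {2}/C' ltnn; congr (_ * _)%E.
apply: eq_big_seq => i; rewrite mem_iota add0n ltnS => /andP[_ ni].
by rewrite /C' ni.
Qed.

(** Both sides are finite measures in [A], the right one being [P] scaled by a constant. They agree
    on the cylinders, which are stable under intersection and generate the past. *)
Lemma past_indep n (A : set Omega) (B : set R) :
  measurable (A : set (past n)) -> measurable B ->
  P (A `&` X n.+1 @^-1` B) = (P A * P (X n.+1 @^-1` B))%E.
Proof.
move=> mA mB; have mXB := measurable_RV n.+1 mB.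
have rB : 0 <= fine (P (X n.+1 @^-1` B)) by rewrite fine_ge0.
have mCI : setI_closed (cylinders n).
  move=> _ _ [C mC ->] [D mD ->].
  exists (fun i => C i `&` D i); first by move=> i; exact: measurableI.
  apply/seteqP; split => w; first by move=> [h1 h2] i ni; split; [exact: h1|exact: h2].
  by move=> h; split => i /h [].
have := @g_sigma_algebra_measure_unique _ R _ (cylinders n)
  (@cylinders_measurable n) (fun=> setT) _ _
  (mrestr P mXB) (mscale (NngNum rB) P) mCI.
move=> /(_ _ _ _ _ A) h.
have : mrestr P mXB A = mscale (NngNum rB) P A.
  apply: h => //.
  - move=> _; exists (fun=> setT) => //.
    by apply/seteqP; split.
  - by rewrite bigcup_const.
  - move=> C /[dup] cC /cylinders_indep /(_ mB) e.
    transitivity (P (C `&` X n.+1 @^-1` B)) => //.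
    rewrite e muleC; congr (_ * _)%E.
    by apply/esym/fineK; rewrite fin_num_measure.
  - by move=> _; rewrite (le_lt_trans (probability_le1 _ _)) ?ltry//;
      exact: measurableI.
by rewrite /mrestr /mscale/= fineK ?fin_num_measure// muleC.
Qed.

(** This stands in for conditioning on the past: independence makes the joint law of the past and
    [X n.+1] a product measure, and Tonelli's theorem integrates the next observation first. *)
Lemma integral_past_next n (f : Omega * R -> \bar R) :
  measurable_fun setT (f : past n * R -> \bar R) -> (forall z, 0 <= f z)%E ->
  (\int[P]_w f (w, X n.+1 w) =
   \int[P]_w \int[distribution P (X n.+1)]_y f (w, y))%E.
Proof.
move=> mf f0.
have mid : measurable_fun setT (id : Omega -> past n).
  by move=> _ B mB; rewrite setTI; exact: past_measurable mB.
pose idm : {mfun Omega >-> past n} := HB.pack (id : Omega -> past n)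
  (isMeasurableFun.Build _ _ _ _ (id : Omega -> past n) mid).
pose j (w : Omega) : past n * R := (w, X n.+1 w).
have mj : measurable_fun setT j.
  by apply/measurable_fun_pairP; split.
pose jm : {mfun Omega >-> (past n * R)%type} := HB.pack j
  (isMeasurableFun.Build _ _ _ _ j mj).
pose mu1 := distribution P idm; pose mu2 := distribution P (X n.+1).
have e : forall E, measurable E -> (mu1 \x mu2)%E E = distribution P jm E.
  apply: product_measure_unique => A B mA mB.
  rewrite /mu1 /mu2 /distribution /pushforward /=.
  by rewrite -(past_indep mA mB).
transitivity (\int[distribution P jm]_z f z)%E.
  by rewrite ge0_integral_distribution.
transitivity (\int[mu1 \x mu2]_z f z)%E.
  by apply: eq_measure_integral => A mA _; exact/esym/e.
rewrite fubini_tonelli1//.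
rewrite /mu1 ge0_integral_distribution//.
- exact: measurable_fun_fubini_tonelli_F.
- by move=> w; rewrite /fubini_F integral_ge0.
Qed.

End past.

Lemma measurable_bool_natr d (T : measurableType d) (R : realType)
    (b : T -> bool) :
  measurable_fun setT b -> measurable_fun setT (fun w => (b w)%:R : R).
Proof.
by move=> mb; apply: (@measurableT_comp _ _ _ _ _ _ (fun c : bool => c%:R : R)).
Qed.

Lemma measurable_bool_set d (T : measurableType d) (b : T -> bool) :
  measurable_fun setT b -> measurable [set w | b w].
Proof.
move=> mb; have := mb measurableT [set true] I; rewrite setTI.
by congr (measurable _); apply/seteqP; split => w /=; case: (b w).
Qed.

Lemma integral_bool d (T : measurableType d) (R : realType)
    (mu : {measure set T -> \bar R}) (b : T -> bool) : measurable_fun setT b ->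
  (\int[mu]_w ((b w)%:R : R)%:E)%E = mu [set w | b w].
Proof.
move=> /measurable_bool_set mb.
rewrite -[in RHS](setIT [set w | b w]) -integral_indic//.
apply: eq_integral => w _; rewrite indicE.
suff -> : (w \in [set w | b w]) = b w by [].
by apply/idP/idP; rewrite inE.
Qed.

(** * Expectations of bounded random variables *)

Section expectation.
Context d (Omega : measurableType d) (R : realType) (P : probability Omega R).
Implicit Types f g : Omega -> R.

Definition bounded_measurable f :=
  measurable_fun setT f /\ exists M : R, forall w, `|f w| <= M.

Lemma bounded_measurable_cst r : bounded_measurable (fun=> r).
Proof. by split; [exact: measurable_cst|exists `|r|]. Qed.

Lemma bounded_measurableD f g : bounded_measurable f -> bounded_measurable g ->
  bounded_measurable (fun w => f w + g w).
Proof.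
move=> [mf [M hM]] [mg [N hN]]; split; first exact: measurable_funD.
by exists (M + N) => w; rewrite (le_trans (ler_normD _ _))// lerD.
Qed.

Lemma bounded_measurableM f g : bounded_measurable f -> bounded_measurable g ->
  bounded_measurable (fun w => f w * g w).
Proof.
move=> [mf [M hM]] [mg [N hN]]; split; first exact: measurable_funM.
by exists (M * N) => w; rewrite normrM ler_pM.
Qed.

Lemma bounded_measurableB f g : bounded_measurable f -> bounded_measurable g ->
  bounded_measurable (fun w => f w - g w).
Proof.
move=> [mf [M hM]] [mg [N hN]]; split; first exact: measurable_funB.
by exists (M + N) => w; rewrite (le_trans (ler_normB _ _))// lerD.
Qed.

Lemma bounded_measurableX f n : bounded_measurable f ->
  bounded_measurable (fun w => f w ^+ n).
Proof.
move=> [mf [M hM]]; split; first exact: measurable_funX.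
by exists (M ^+ n) => w; rewrite normrX lerXn2r ?nnegrE// (le_trans _ (hM w)).
Qed.

Lemma bounded_measurable_bool (b : Omega -> bool) : measurable_fun setT b ->
  bounded_measurable (fun w => (b w)%:R).
Proof.
move=> mb; split; first exact: measurable_bool_natr.
by exists 1 => w; case: (b w); rewrite ?normr1 ?normr0.
Qed.

Lemma bounded_measurable_sum n (f : nat -> Omega -> R) :
  (forall i, bounded_measurable (f i)) ->
  bounded_measurable (fun w => \sum_(i < n) f i w).
Proof.
move=> h; elim: n => [|n IH].
  by under eq_fun do rewrite big_ord0; exact: bounded_measurable_cst.
by under eq_fun do rewrite big_ord_recr; exact: bounded_measurableD.
Qed.

Lemma bounded_integrable f :
  bounded_measurable f -> P.-integrable setT (EFin \o f).
Proof.
move=> [mf [M hM]]; apply: measurable_bounded_integrable => //.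
  by rewrite (le_lt_trans (probability_le1 _ _))// ltry.
exists M; split; first exact: num_real.
by move=> N MN w _ /=; rewrite (le_trans (hM w))// ltW.
Qed.

Lemma expect_sum n (f : nat -> Omega -> R) :
  (forall i, bounded_measurable (f i)) ->
  \int[P]_w (\sum_(i < n) f i w) = \sum_(i < n) \int[P]_w f i w.
Proof.
move=> h; elim: n => [|n IH].
  under eq_Rintegral do rewrite big_ord0.
  by rewrite big_ord0 Rintegral_cst// mul0r.
under eq_Rintegral do rewrite big_ord_recr/=.
rewrite RintegralD//; first by rewrite IH big_ord_recr.
- exact/bounded_integrable/bounded_measurable_sum.
- exact: bounded_integrable.
Qed.

Lemma expect_le f g : bounded_measurable f -> bounded_measurable g ->
  (forall w, f w <= g w) -> \int[P]_w f w <= \int[P]_w g w.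
Proof.
by move=> bf bg fg; apply: le_Rintegral => //; exact: bounded_integrable.
Qed.

Lemma expectD f g : bounded_measurable f -> bounded_measurable g ->
  \int[P]_w (f w + g w) = \int[P]_w f w + \int[P]_w g w.
Proof. by move=> bf bg; apply: RintegralD => //; exact: bounded_integrable. Qed.

Lemma expectB f g : bounded_measurable f -> bounded_measurable g ->
  \int[P]_w (f w - g w) = \int[P]_w f w - \int[P]_w g w.
Proof. by move=> bf bg; apply: RintegralB => //; exact: bounded_integrable. Qed.

Lemma expect_cst (r : R) : \int[P]_w r = r.
Proof. by rewrite Rintegral_cst// [X in fine X]probability_setT mulr1. Qed.

Lemma expect_bool (b : Omega -> bool) : measurable_fun setT b ->
  (\int[P]_w (b w)%:R)%:E = P [set w | b w].
Proof.
move=> mb; rewrite -integral_bool// fineK//.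
exact/integrable_fin_num/bounded_integrable/bounded_measurable_bool.
Qed.

Lemma chebyshev_sqr f (e : R) : bounded_measurable f -> 0 < e ->
  (P [set w | (e <= `|f w|)%R] <= (\int[P]_w (f w ^+ 2) / e ^+ 2)%:E)%E.
Proof.
move=> bf e0; have mb : measurable_fun setT (fun w => e <= `|f w|).
  apply: measurable_fun_ler => //; apply: measurableT_comp => //.
  by case: bf.
rewrite -(expect_bool mb) lee_fin ler_pdivlMr ?exprn_gt0//.
rewrite -RintegralZr//; last exact/bounded_integrable/bounded_measurable_bool.
apply: expect_le.
- apply: bounded_measurableM; last exact: bounded_measurable_cst.
  exact: bounded_measurable_bool.
- exact: bounded_measurableX.
- move=> w; case: (leP e `|f w|) => h; last by rewrite mul0r sqr_ge0.
  by rewrite mul1r -[f w ^+ 2]real_normK ?num_real// lerXn2r ?nnegrE// ltW.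
Qed.

End expectation.

(** * The next observation against a threshold known in advance *)

Section next_observation.
Context d (Omega : measurableType d) (R : realType) (P : probability Omega R).
Variables (X : nat -> {RV P >-> R}) (F : R -> R).
Hypothesis X_iid : iid_with_cdf X F.

Lemma P_gt i y : P [set w | y < X i w] = (1 - F y)%:E.
Proof.
have <- : ~` (X i @^-1` `]-oo, y]) = [set w | y < X i w].
  apply/seteqP; split => w /=; rewrite in_itv/= ltNge; first by move/negP.
  by move=> /negP.
rewrite probability_setC; last exact: measurable_RV.
by have := X_iid.2 i y; rewrite /cdf /distribution /pushforward => ->.
Qed.

Lemma F_ge0 y : 0 <= F y.
Proof. by rewrite -lee_fin -(X_iid.2 0%N y). Qed.

Lemma F_nd x y : x <= y -> F x <= F y.
Proof.
by move=> xy; rewrite -lee_fin -!(X_iid.2 0%N); exact: cdf_nondecreasing.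
Qed.

Lemma F_measurable : measurable_fun setT F.
Proof. by apply: nondecreasing_measurable => // x y; exact: F_nd. Qed.

Lemma integral_exceed n (y : R) :
  (\int[distribution P (X n)]_x ((y < x)%R%:R : R)%:E)%E = (1 - F y)%:E.
Proof.
rewrite integral_bool; last exact: measurable_fun_ltr.
by rewrite -(P_gt n).
Qed.

Lemma measurable_exceed n (c : Omega -> R) : adapted X n c ->
  measurable_fun setT (fun w => c w < X n.+1 w).
Proof. by move=> /adapted_measurable mc; exact: measurable_fun_ltr. Qed.

Lemma bounded_measurable_tail n (c : Omega -> R) : adapted X n c ->
  bounded_measurable (fun w => 1 - F (c w)).
Proof.
move=> /adapted_measurable mc; split.
  apply: measurable_funB => //; apply: measurableT_comp => //.
  exact: F_measurable.
exists 1 => w; rewrite ger0_norm ?gerBl ?F_ge0//.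
by rewrite -lee_fin -(P_gt 0%N).
Qed.

Lemma expect_exceed_ge0 n (g c : Omega -> R) : adapted X n g ->
  adapted X n c -> bounded_measurable g -> (forall w, 0 <= g w) ->
  \int[P]_w (g w * (c w < X n.+1 w)%R%:R) = \int[P]_w (g w * (1 - F (c w))).
Proof.
move=> ag ac bg g0; congr fine.
pose f (z : Omega * R) : \bar R := (g z.1 * (c z.1 < z.2)%R%:R)%:E.
have mf : measurable_fun setT (f : past X n * R -> \bar R).
  apply/measurable_EFinP; apply: measurable_funM.
    exact: (measurableT_comp ag).
  apply: measurable_bool_natr; apply: measurable_fun_ltr => //.
  exact: (measurableT_comp ac).
rewrite [LHS](@integral_past_next _ _ _ _ _ X_iid.1 n f mf); last first.
  by move=> z; rewrite lee_fin mulr_ge0.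
apply: eq_integral => w _; rewrite /f /=.
under eq_integral do rewrite EFinM.
rewrite ge0_integralZl//.
- by rewrite integral_exceed.
- apply/measurable_EFinP; apply: measurable_bool_natr.
  exact: measurable_fun_ltr.
- by rewrite lee_fin.
Qed.

(** The bound [M] of [g] makes [g + M] nonnegative, and linearity removes the constant again. *)
Lemma expect_exceed n (g c : Omega -> R) : adapted X n g ->
  adapted X n c -> bounded_measurable g ->
  \int[P]_w (g w * (c w < X n.+1 w)%R%:R) = \int[P]_w (g w * (1 - F (c w))).
Proof.
move=> ag ac bg; have [mg [M hM]] := bg.
have bM := bounded_measurable_cst Omega M.
have bE := bounded_measurable_bool R (measurable_exceed ac).
have bT := bounded_measurable_tail ac.
have M0 (w : Omega) : 0 <= M by rewrite (le_trans _ (hM w)).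
have bgM : bounded_measurable (fun w => g w + M) by exact: bounded_measurableD.
have agM : adapted X n (fun w => g w + M) by exact: measurable_funD.
have h2 := @expect_exceed_ge0 n (fun=> M) c (measurable_cst _) ac bM M0.
have h1 : \int[P]_w ((g w + M) * (c w < X n.+1 w)%R%:R) =
    \int[P]_w ((g w + M) * (1 - F (c w))).
  apply: expect_exceed_ge0 => // w.
  by have := hM w; rewrite ler_norml -lerBlDr sub0r => /andP[].
have sub (k : Omega -> R) : bounded_measurable k ->
    \int[P]_w (g w * k w) =
    \int[P]_w ((g w + M) * k w) - \int[P]_w (M * k w).
  move=> bk; rewrite -RintegralB//.
  - by apply: eq_Rintegral => w _; ring.
  - exact/bounded_integrable/bounded_measurableM.
  - exact/bounded_integrable/bounded_measurableM.
by rewrite !sub// h1 h2.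
Qed.

End next_observation.

(** * Convergence of martingale transforms *)

Lemma cvgn_cauchy (R : realType) (u : nat -> R) :
  (forall e, 0 < e -> exists m, forall n, (m <= n)%N -> `|u n - u m| < e) ->
  cvgn u.
Proof.
move=> h; apply/cauchy_cvgP/cauchy_exP => e e0; have [m hm] := h e e0.
exists (u m); exists m => // n /= mn.
by rewrite /ball/= distrC hm.
Qed.

Section martingale.
Context d (Omega : measurableType d) (R : realType) (P : probability Omega R).
Variables (X : nat -> {RV P >-> R}) (F : R -> R).
Hypothesis X_iid : iid_with_cdf X F.
Variable c : nat -> Omega -> R.
Hypothesis ac : forall i, adapted X i (c i).

Definition exceed i w : R := (c i w < X i.+1 w)%R%:R.

(** A martingale transform: [a i] and [c i] will be known at time [i], while [exceed i] is decided
    by observation [i.+1] and is centred by its conditional probability. *)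
Definition mart (a : nat -> Omega -> R) n w : R :=
  \sum_(i < n) a i w * (exceed i w - (1 - F (c i w))).

Lemma martS a n w :
  mart a n.+1 w = mart a n w + a n w * (exceed n w - (1 - F (c n w))).
Proof. by rewrite /mart big_ord_recr. Qed.

Lemma exceed_bm i : bounded_measurable (exceed i).
Proof. exact/bounded_measurable_bool/measurable_exceed. Qed.

Lemma tail_bm i : bounded_measurable (fun w => 1 - F (c i w)).
Proof. exact (bounded_measurable_tail X_iid (@ac i)). Qed.

Lemma tail_adapted i : adapted X i (fun w => 1 - F (c i w)).
Proof.
apply: measurable_funB => //; apply: measurableT_comp => //.
  exact: F_measurable X_iid.
exact: ac.
Qed.

Lemma exceed_adapted i : adapted X i.+1 (exceed i).
Proof.
apply: measurable_bool_natr; apply: measurable_fun_ltr.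
  exact: (adaptedS (leqnSn i)).
exact: (@adapted_X _ _ _ P X i.+1 i.+1).
Qed.

Lemma mart_bm (a : nat -> Omega -> R) n : (forall i, bounded_measurable (a i)) ->
  bounded_measurable (mart a n).
Proof.
move=> ba; apply: (@bounded_measurable_sum _ _ _ n
  (fun i w => a i w * (exceed i w - (1 - F (c i w))))) => i.
apply: bounded_measurableM => //; apply: bounded_measurableB.
  exact: exceed_bm.
exact: tail_bm.
Qed.

Lemma mart_adapted (a : nat -> Omega -> R) n : (forall i, adapted X i (a i)) ->
  adapted X n (mart a n).
Proof.
move=> aa; elim: n => [|n IH].
  by rewrite /adapted /mart; under eq_fun do rewrite big_ord0; exact: measurable_cst.
have -> : mart a n.+1 = fun w => mart a n w + a n w * (exceed n w - (1 - F (c n w))).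
  by apply/funext => w; exact: martS.
apply: measurable_funD; first exact: (adaptedS (leqnSn n)).
apply: measurable_funM; first exact: (adaptedS (leqnSn n)).
apply: measurable_funB; first exact: exceed_adapted.
exact: (adaptedS (leqnSn n) (@tail_adapted n)).
Qed.

(* Orthogonality of the increments; [xi ^+ 2 = xi] turns the conditional
   variance [p - p ^+ 2] into at most [E xi]. *)
Lemma mart_sqr (a : nat -> Omega -> R) n : (forall i, adapted X i (a i)) ->
  (forall i, bounded_measurable (a i)) ->
  \int[P]_w (mart a n w ^+ 2) <=
  \sum_(i < n) \int[P]_w (a i w ^+ 2 * exceed i w).
Proof.
move=> aa ba; elim: n => [|n IH].
  rewrite big_ord0 (@eq_Rintegral _ _ _ _ _ (fun=> 0)) ?expect_cst//.
  by move=> w _; rewrite /mart big_ord0 expr0n.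
rewrite big_ord_recr/=.
pose p w := 1 - F (c n w).
have bp : bounded_measurable p by exact: tail_bm.
have ap : adapted X n p by exact: tail_adapted.
have bM := mart_bm n ba; have aM : adapted X n (mart a n) := mart_adapted aa.
have bx := exceed_bm n.
pose k w := 2 * (mart a n w * a n w).
have bk : bounded_measurable k.
  by apply: bounded_measurableM; [exact: bounded_measurable_cst|exact: bounded_measurableM].
have ak : adapted X n k.
  apply: measurable_funM; first exact: measurable_cst.
  exact: (measurable_funM aM (aa n)).
pose q w := a n w ^+ 2 * p w.
have ba2 : bounded_measurable (fun w => a n w ^+ 2) by exact: bounded_measurableX.
have bq : bounded_measurable q by exact: bounded_measurableM.
have aq : adapted X n q.
  by apply: measurable_funM => //; apply: measurable_funX; exact: aa.
have eqk := expect_exceed X_iid ak (@ac n) bk.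
have eqq := expect_exceed X_iid aq (@ac n) bq.
have bkx : bounded_measurable (fun w => k w * exceed n w) by exact: bounded_measurableM.
have bkp : bounded_measurable (fun w => k w * p w) by exact: bounded_measurableM.
have bqx : bounded_measurable (fun w => q w * exceed n w) by exact: bounded_measurableM.
have bqp : bounded_measurable (fun w => q w * p w) by exact: bounded_measurableM.
have bax : bounded_measurable (fun w => a n w ^+ 2 * exceed n w) by exact: bounded_measurableM.
have bM2 : bounded_measurable (fun w => mart a n w ^+ 2) by exact: bounded_measurableX.
(* The square is expanded so that [exceed n] occurs linearly, with coefficients known at time [n].
   In expectation it may then be replaced by [p]: the cross term in [k] vanishes, and the terms in
   [q] leave minus the expectation of [q * p], which is at most 0. *)
have -> : \int[P]_w (mart a n.+1 w ^+ 2) = \int[P]_w (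
   ((mart a n w ^+ 2 + a n w ^+ 2 * exceed n w) + (k w * exceed n w - k w * p w))
   + ((q w * p w - q w * exceed n w) - q w * exceed n w)).
  apply: eq_Rintegral => w _; rewrite martS /k /q /p.
  have : exceed n w ^+ 2 = exceed n w.
    by rewrite /exceed; case: (_ < _); rewrite ?expr1n ?expr0n.
  move: (exceed n w) => x x2.
  transitivity (mart a n w ^+ 2 + a n w ^+ 2 * x ^+ 2 +
    2 * (mart a n w * a n w) * (x - (1 - F (c n w))) + a n w ^+ 2 * ((1 - F (c n w)) ^+ 2
     - 2 * x * (1 - F (c n w)))); first by ring.
  by rewrite x2; ring.
have bd := bounded_measurableB.
rewrite (expectD P (bounded_measurableD (bounded_measurableD bM2 bax)
  (bd _ _ _ _ _ bkx bkp)) (bd _ _ _ _ _ (bd _ _ _ _ _ bqp bqx) bqx)).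
rewrite (expectD P (bounded_measurableD bM2 bax) (bd _ _ _ _ _ bkx bkp)).
rewrite (expectD P bM2 bax) (expectB P bkx bkp).
rewrite (expectB P (bd _ _ _ _ _ bqp bqx) bqx) (expectB P bqp bqx).
have : 0 <= \int[P]_w (q w * p w).
  apply: Rintegral_ge0 => w _; rewrite /q -mulrA -[p w * p w]expr2.
  by rewrite mulr_ge0// sqr_ge0.
rewrite -[\int[P]_w (k w * exceed n w)]/(\int[P]_w (k w * (c n w < X n.+1 w)%R%:R)) eqk.
rewrite -[\int[P]_w (q w * exceed n w)]/(\int[P]_w (q w * (c n w < X n.+1 w)%R%:R)) eqq.
rewrite -/p; lra.
Qed.


(** * A maximal inequality *)

Section maximal_inequality.
Variable a : nat -> Omega -> R.
Hypothesis aa : forall i, adapted X i (a i).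
Hypothesis ba : forall i, bounded_measurable (a i).
Variables (e : R) (m : nat).
Hypothesis e_gt0 : 0 < e.

(* [mart a] started at time [m] and frozen once its modulus reaches [e];
   freezing only multiplies the predictable coefficients by an indicator, so
   the maximal inequality follows from Chebyshev's inequality. *)
Fixpoint frozen n w : R := if n is k.+1 then
    frozen k w + ((m <= k)%N && (`|frozen k w| < e))%:R * a k w *
      (exceed k w - (1 - F (c k w)))
  else 0.

Definition frozen_coef k w : R := ((m <= k)%N && (`|frozen k w| < e))%:R * a k w.

Lemma frozenE n w : frozen n w = mart frozen_coef n w.
Proof.
elim: n => [|n IH]; first by rewrite /mart big_ord0.
by rewrite martS -IH.
Qed.

Lemma measurable_guard d' (T : measurableType d') n (f : T -> R) :
  measurable_fun setT f ->
  measurable_fun setT (fun w => (m <= n)%N && (`|f w| < e)).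
Proof.
move=> mf; apply: measurable_and => //; apply: measurable_fun_ltr => //.
exact: measurableT_comp.
Qed.

Lemma frozen_adapted n : adapted X n (frozen n).
Proof.
elim: n => [|n IH]; first exact: measurable_cst.
apply: measurable_funD; first exact: (adaptedS (leqnSn n)).
apply: measurable_funM.
  apply: measurable_funM; last exact: (adaptedS (leqnSn n)).
  apply/measurable_bool_natr/measurable_guard.
  exact: (adaptedS (leqnSn n) IH).
apply: measurable_funB; first exact: exceed_adapted.
exact: (adaptedS (leqnSn n) (@tail_adapted n)).
Qed.

Lemma frozen_coef_adapted n : adapted X n (frozen_coef n).
Proof.
apply: measurable_funM; last exact: aa.
apply: measurable_bool_natr; apply: measurable_guard.
exact: (@frozen_adapted n).
Qed.

Lemma frozen_coef_bm n : bounded_measurable (frozen_coef n).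
Proof.
apply: bounded_measurableM => //; apply: bounded_measurable_bool.
apply: measurable_guard; exact: adapted_measurable (@frozen_adapted n).
Qed.

Lemma frozen_bm n : bounded_measurable (frozen n).
Proof.
have -> : frozen n = mart frozen_coef n by apply/funext => w; exact: frozenE.
exact/mart_bm/frozen_coef_bm.
Qed.

Lemma frozen_start w : frozen m w = 0.
Proof.
have : forall n, (n <= m)%N -> frozen n w = 0.
  elim=> // n IH nm; rewrite /= IH ?(ltnW nm)//.
  by rewrite leqNgt nm/= !mul0r addr0.
exact.
Qed.

Lemma frozen_stays n k w : e <= `|frozen n w| -> frozen (n + k) w = frozen n w.
Proof.
move=> h; elim: k => [|k IH]; first by rewrite addn0.
by rewrite addnS /= IH (ltNge _ e) h andbF !mul0r addr0.
Qed.

Lemma frozen_mart n w : (m <= n)%N ->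
  (e <= `|frozen n w|) \/ frozen n w = mart a n w - mart a m w.
Proof.
move=> /subnKC <-; elim: (n - m)%N => [|k IH].
  by right; rewrite addn0 frozen_start subrr.
have [h|h] := leP e `|frozen (m + k) w|.
  by left; rewrite addnS -addn1 frozen_stays.
case: IH; first by rewrite leNgt h.
move=> E; right; rewrite addnS /= h leq_addr/= mul1r martS E.
by rewrite addrAC.
Qed.

Lemma mart_frozen n w : (m <= n)%N -> e <= `|mart a n w - mart a m w| ->
  e <= `|frozen n w|.
Proof. by move=> /(@frozen_mart n w)[//|->]. Qed.

Lemma frozen_sqr n : (m <= n)%N ->
  \int[P]_w (frozen n w ^+ 2) <=
  \sum_(m <= i < n) \int[P]_w (a i w ^+ 2 * exceed i w).
Proof.
move=> mn; under eq_Rintegral do rewrite frozenE.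
apply: (le_trans (mart_sqr _ frozen_coef_adapted frozen_coef_bm)).
rewrite -(big_mkord predT (fun i => \int[P]_w (frozen_coef i w ^+ 2 * exceed i w))).
rewrite (big_cat_nat (leq0n m) mn)/= [X in X + _]big1_seq ?add0r; last first.
  move=> i; rewrite mem_index_iota /= => im.
  rewrite (@eq_Rintegral _ _ _ _ _ (fun=> 0)) ?expect_cst// => w _.
  by rewrite /frozen_coef leqNgt im/= mul0r expr0n mul0r.
apply: ler_sum => i _; apply: expect_le.
- apply: bounded_measurableM; last exact: exceed_bm.
  exact/bounded_measurableX/frozen_coef_bm.
- by apply: bounded_measurableM; [exact: bounded_measurableX|exact: exceed_bm].
- move=> w; rewrite ler_wpM2r ?ler0n// /frozen_coef exprMn ler_piMl ?sqr_ge0//.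
  by case: (_ && _); rewrite ?expr1n ?expr0n.
Qed.

(** Written with [frozen] rather than [mart], because the sets in the union then increase with [n],
    and the probability of the union is the limit of theirs. *)
Definition oscillation : set Omega :=
  \bigcup_n [set w | (e <= `|frozen (m + n) w|)%R].

Lemma measurable_frozen_ge n : measurable [set w | (e <= `|frozen n w|)%R].
Proof.
apply: measurable_bool_set; apply: measurable_fun_ler => //.
by apply: measurableT_comp => //; case: (frozen_bm n).
Qed.

Lemma measurable_oscillation : measurable oscillation.
Proof. by apply: bigcupT_measurable => n; exact: measurable_frozen_ge. Qed.

Lemma maximal_inequality (C : R) :
  (forall n, (m <= n)%N ->
    \sum_(m <= i < n) \int[P]_w (a i w ^+ 2 * exceed i w) <= C) ->
  (P oscillation <= (C / e ^+ 2)%:E)%E.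
Proof.
move=> hC.
have mO n := measurable_frozen_ge (m + n).
have cv := @nondecreasing_cvg_mu _ _ _ P _ mO measurable_oscillation _.
have {}cv := cv ltac:(
  move=> i j ij; apply/subsetPset => w /= h;
  rewrite -(subnKC ij) addnA frozen_stays//; exact: h).
rewrite /oscillation; apply: (cvge_le _ cv).
apply: nearW => n /=; apply: (le_trans (chebyshev_sqr P (@frozen_bm (m + n)) e_gt0)).
rewrite lee_fin ler_wpM2r ?invr_ge0 ?sqr_ge0//.
apply: (le_trans (frozen_sqr _)); first exact: leq_addr.
by apply: hC; exact: leq_addr.
Qed.

End maximal_inequality.

(** The second moments have a convergent sum, so its tails make the probability of an oscillation
    after time [m] arbitrarily small. Paths that oscillate by [k.+1%:R^-1] after every [m] hence
    form a null set for each [k]; outside their union the path is Cauchy. *)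
Theorem mart_cvg (a : nat -> Omega -> R) (C : R) :
  (forall i, adapted X i (a i)) -> (forall i, bounded_measurable (a i)) ->
  (forall n, \sum_(i < n) \int[P]_w (a i w ^+ 2 * exceed i w) <= C) ->
  {ae P, forall w, cvgn (fun n => mart a n w)}.
Proof.
move=> aa ba hC.
pose t i := \int[P]_w (a i w ^+ 2 * exceed i w).
have t0 i : 0 <= t i.
  by apply: Rintegral_ge0 => w _; rewrite mulr_ge0 ?sqr_ge0 ?ler0n.
have tail e : 0 < e -> exists m, forall n, (m <= n)%N -> \sum_(m <= i < n) t i <= e.
  move=> e0; pose s n := \sum_(0 <= i < n) t i.
  have cs : cvgn s.
    apply: nondecreasing_is_cvgn.
      move=> i j ij; rewrite /s (big_cat_nat (leq0n i) ij)/= lerDl sumr_ge0// => k _.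
    by exists C => _ [n _ <-]; rewrite /s big_mkord; exact: hC.
  move/cvgrPdist_lt : cs => /(_ (e / 2)); rewrite divr_gt0// => /(_ isT)[m _ hm].
  exists m => n mn; have h1 := hm m (leqnn m); have h2 := hm n mn.
  have -> : \sum_(m <= i < n) t i = s n - s m.
    by rewrite /s (big_cat_nat (leq0n m) mn)/= addrAC subrr add0r.
  move: h1 h2; rewrite /= !ltr_norml; lra.
pose N k := \bigcap_m oscillation a (k.+1%:R^-1) m.
have N0 k : P.-negligible (N k).
  have mN : measurable (N k).
    by apply: bigcapT_measurable => m; exact: measurable_oscillation.
  apply/negligibleP => //; apply/eqP; rewrite eq_le measure_ge0 andbT.
  apply/lee_addgt0Pr => e e0; rewrite add0e.
  (* The factor [k.+1%:R^-1 ^+ 2] cancels the denominator of the maximal inequality. *)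
  have [m hm] := tail (e * k.+1%:R^-1 ^+ 2) ltac:(by rewrite mulr_gt0 ?exprn_gt0 ?invr_gt0).
  apply: (@le_trans _ _ (P (oscillation a (k.+1%:R^-1) m))).
    apply: le_measure; rewrite ?inE//; first exact: measurable_oscillation.
    exact: bigcap_inf.
  have := @maximal_inequality a aa ba (k.+1%:R^-1) m _ _ hm.
  by rewrite mulfK; [apply; rewrite invr_gt0|rewrite expf_neq0 ?invr_eq0 ?pnatr_eq0].
have /negligibleS : P.-negligible (\bigcup_k N k) by exact: negligible_bigcup.
apply => w /= nc; apply: contrapT => nN; apply: nc.
apply: cvgn_cauchy => e e0.
have [k] : exists k : nat, k.+1%:R^-1 < e.
  have [k hk] := @ltr_add_invr R 0 e e0; exists k.
  by move: hk; rewrite add0r.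
move=> ke; have : ~ N k w by move=> h; apply: nN; exists k.
move=> /existsNP[m /not_implyP[_ hm]]; exists m => n mn.
rewrite ltNge; apply/negP => h; apply: hm; exists (n - m)%N => //=.
rewrite subnKC//; apply: mart_frozen => //; exact: le_trans (ltW ke) h.
Qed.

End martingale.

(** * Increments of the hazard *)

Lemma kronecker (R : realType) (b y : nat -> R) :
  (forall n, 0 < b n) -> (forall n, b n <= b n.+1) ->
  (forall A, exists n, A <= b n) ->
  cvgn (fun n => \sum_(i < n) y i / b i) ->
  forall e, 0 < e ->
    exists m, forall n, (m <= n)%N -> `|(\sum_(i < n.+1) y i) / b n| < e.
Proof.
move=> b0 bS b_unbounded cv e e0.
have b_nd i j : (i <= j)%N -> b i <= b j.
  move=> /subnKC <-; elim: (j - i)%N => [|k IH]; first by rewrite addn0.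
  by rewrite addnS (le_trans IH).
pose l := limn (fun n => \sum_(i < n) y i / b i).
pose t n := \sum_(i < n) y i / b i - l.
have e4 : 0 < e / 4 by rewrite divr_gt0.
have [m hm] : exists m, forall n, (m <= n)%N -> `|t n| < e / 4.
  move/cvgrPdist_lt : cv => /(_ _ e4)[m _ hm]; exists m => n /hm.
  by rewrite distrC.
(* Summation by parts: [W] changes only by increments of [b] times the remainder [t]. Past [m] the
   three contributions, [W m], the later changes of [W], and [b n * t n.+1], are each at most
   [e / 4 * b n] once [b n] is large, which explains the quarter. *)
pose W n := \sum_(i < n.+1) y i - b n * t n.+1.
have WS n : W n.+1 = W n - (b n.+1 - b n) * t n.+1.
  rewrite /W /t !(big_ord_recr n.+1)/=.
  have := lt0r_neq0 (b0 n.+1); move: (\sum_(i < n.+1) y i) => s1.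
  move: (\sum_(i < n.+1) y i / b i) => s2 bn0.
  by field.
have bW n : (m <= n)%N -> `|W n| <= `|W m| + e / 4 * b n.
  move=> /subnKC <-; elim: (n - m)%N => [|k IH].
    by rewrite addn0 lerDl mulr_ge0 ?ltW.
  rewrite addnS WS (le_trans (ler_normB _ _))//.
  have h1 : `|t (m + k).+1| <= e / 4 by rewrite ltW// hm// leqW// leq_addr.
  have h2 : 0 <= b (m + k).+1 - b (m + k)%N by rewrite subr_ge0.
  rewrite normrM (ger0_norm h2).
  have := ler_wpM2l h2 h1; move: IH; nra.
have [p hp] := b_unbounded (`|W m| / (e / 4)).
exists (maxn m p) => n; rewrite geq_max => /andP[mn pn].
rewrite normrM normfV (gtr0_norm (b0 n)) ltr_pdivrMr//.
have -> : \sum_(i < n.+1) y i = W n + b n * t n.+1 by rewrite /W subrK.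
have h1 : `|t n.+1| < e / 4 by rewrite hm// leqW.
have h2 : `|W m| <= e / 4 * b n.
  by rewrite mulrC -ler_pdivrMr// (le_trans hp)// b_nd.
have h3 := bW _ mn.
rewrite (le_lt_trans (ler_normD _ _))// normrM (gtr0_norm (b0 n)).
have := b0 n; move: h1 h2 h3 e0; nra.
Qed.

(** * Increments of powers, and logarithms against powers *)

Section powR_increments.
Context {R : realType}.
Implicit Types (a m u v x L : R).

Lemma powR_ge1 a x : 0 <= a -> 1 <= x -> 1 <= x `^ a.
Proof.
move=> a0 x1; have x0 : 0 <= x by rewrite (le_trans ler01).
have -> : 1 = 1 `^ a :> R by rewrite powR1.
by rewrite ge0_ler_powR ?nnegrE.
Qed.

Lemma powR_mvt a u v : 0 < u -> u < v ->
  exists2 x, u < x < v & v `^ a - u `^ a = a * x `^ (a - 1) * (v - u).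
Proof.
move=> u0 uv.
have [||x xuv ->] := @MVT R (@powR R ^~ a) (fun x => a * x `^ (a - 1)) u v uv.
- move=> x; rewrite in_itv/= => /andP[ux _].
  by apply: is_derive1_powR; exact: lt_trans ux.
- apply: derivable_within_continuous => x; rewrite in_itv/= => /andP[ux _].
  by apply: derivable_powR; rewrite in_itv/= andbT (lt_le_trans u0).
by exists x => //; move: xuv; rewrite in_itv.
Qed.

(** The hypotheses are symmetric in [x] and [y] because a negative exponent exchanges their roles;
    the exponent of interest is [alpha - 1], of either sign. *)
Lemma powR_ratio_le a x y r : 0 < x -> 0 < y -> 1 <= r ->
  x <= r * y -> y <= r * x -> x `^ a <= r `^ `|a| * y `^ a.
Proof.
move=> x0 y0 r1 xy yx; have r0 : 0 < r by rewrite (lt_le_trans ltr01).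
have [x0' y0' r0'] := And3 (ltW x0) (ltW y0) (ltW r0).
have [a0|a0] := leP 0 a.
  rewrite ger0_norm// -powRM//.
  by rewrite ge0_ler_powR ?nnegrE// mulr_ge0.
have ha : 0 <= - a by rewrite oppr_ge0 ltW.
rewrite ltr0_norm// -[in x `^ a](opprK a) -[in y `^ a](opprK a) !(powRN _ (- a)).
rewrite ler_pdivlMr ?powR_gt0// mulrC ler_pdivrMr ?powR_gt0// -powRM//.
by rewrite ge0_ler_powR ?nnegrE// mulr_ge0.
Qed.

(* Both increments are evaluated by the mean value theorem; the two
   intermediate points differ by a factor at most [x / m], which is at most
   [(1 + L) `^ a^-1] because [m `^ a >= 1]. *)
Lemma powR_increment_le a m x L n : 0 < a -> 1 <= m -> m < x -> (0 < n)%N ->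
  L = x `^ a - m `^ a ->
  (m + (x - m) / n%:R) `^ a - m `^ a <= L * (1 + L) `^ (`|a - 1| / a) / n%:R.
Proof.
move=> a0 m1 mx n0 LE.
have m0 : 0 < m by rewrite (lt_le_trans ltr01).
have x0 : 0 < x by exact: lt_trans mx.
have [m0' x0' a0'] := And3 (ltW m0) (ltW x0) (ltW a0).
have n0' : 0 < n%:R :> R by rewrite ltr0n.
have n1 : 1 <= n%:R :> R by rewrite ler1n.
have d0 : 0 < x - m by rewrite subr_gt0.
have mm' : m < m + (x - m) / n%:R by rewrite ltrDl divr_gt0.
have m'x : m + (x - m) / n%:R <= x.
  by rewrite -lerBrDl ler_pdivrMr// ler_peMr// ltW.
have [u /andP[mu um'] ->] := powR_mvt a m0 mm'.
have [v /andP[mv vx] eL] := powR_mvt a m0 mx.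
have u0 : 0 < u by exact: lt_trans mu.
have v0 : 0 < v by exact: lt_trans mv.
have ux : u < x by exact: lt_le_trans m'x.
have r1 : 1 <= x / m by rewrite ler_pdivlMr// mul1r ltW.
have r0 : 0 <= x / m by rewrite divr_ge0.
have rm : x / m * m = x by rewrite divfK// gt_eqF.
have h : u `^ (a - 1) <= (x / m) `^ `|a - 1| * v `^ (a - 1).
  apply: powR_ratio_le => //.
    rewrite (le_trans (ltW ux))// -[leLHS]rm ler_wpM2l//; exact: ltW.
  rewrite (le_trans (ltW vx))// -[leLHS]rm ler_wpM2l//; exact: ltW.
have ma1 : 1 <= m `^ a.
  exact: powR_ge1.
have L0 : 0 <= L.
  rewrite LE subr_ge0 ge0_ler_powR ?nnegrE//; exact: ltW.
have L1 : 0 <= 1 + L by rewrite addr_ge0.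
have xm : x / m <= (1 + L) `^ a^-1.
  have xa : (x / m) `^ a <= 1 + L.
    rewrite -(ler_pM2r (lt_le_trans ltr01 ma1)) -powRM// rm.
    have -> : x `^ a = m `^ a + L by rewrite LE addrC subrK.
    by rewrite mulrDl mul1r lerD2l ler_peMr.
  have -> : x / m = (x / m) `^ a `^ a^-1 by rewrite -powRrM mulfV ?gt_eqF// powRr1.
  by rewrite ge0_ler_powR ?nnegrE ?powR_ge0 ?invr_ge0.
have xm' : (x / m) `^ `|a - 1| <= (1 + L) `^ (`|a - 1| / a).
  have -> : `|a - 1| / a = a^-1 * `|a - 1| by rewrite mulrC.
  by rewrite powRrM ge0_ler_powR ?nnegrE ?powR_ge0.
have hu : u `^ (a - 1) <= (1 + L) `^ (`|a - 1| / a) * v `^ (a - 1).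
  by rewrite (le_trans h)// ler_wpM2r ?powR_ge0.
rewrite addrAC subrr add0r mulrA ler_wpM2r ?invr_ge0 ?ler0n//.
rewrite {1}LE eL.
have -> : a * v `^ (a - 1) * (x - m) * (1 + L) `^ (`|a - 1| / a) =
  a * ((1 + L) `^ (`|a - 1| / a) * v `^ (a - 1)) * (x - m) by ring.
by apply: ler_wpM2r (ltW d0) _ _ _; exact: ler_wpM2l.
Qed.

Lemma ln_powR_bound (e y : R) : 0 < e -> 1 <= y -> ln y <= y `^ e / e.
Proof.
move=> e0 y1; have y0 : 0 < y by rewrite (lt_le_trans ltr01).
rewrite ler_pdivlMr// mulrC -ln_powR.
by rewrite ltW// ln_sublinear// powR_gt0.
Qed.

End powR_increments.

(** For [k >= 1] this is [1 / (k * (k + 1))]: summable over the retained values, yet with a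
    logarithm of size at most [2 * ln (k + 1)]. *)
Definition gap {R : realType} (k : nat) : R := k%:R^-1 - k.+1%:R^-1.

(** The power 3/4 as nested square roots: its square is [k] times the square root of [k], so
    comparisons become polynomial in that root. *)
Definition root34 {R : realType} (k : nat) : R :=
  Num.sqrt (k%:R * Num.sqrt k%:R).

Section root34.
Context {R : realType}.

Lemma root34_gt0 k : (0 < k)%N -> 0 < root34 k :> R.
Proof. by move=> k0; rewrite sqrtr_gt0 mulr_gt0 ?sqrtr_gt0 ?ltr0n. Qed.

Lemma root34_ge1 k : (0 < k)%N -> 1 <= root34 k :> R.
Proof.
move=> k0; have k1 : 1 <= k%:R :> R by rewrite ler1n.
rewrite -[leLHS]sqrtr1 ler_sqrt ?mulr_gt0 ?sqrtr_gt0 ?ltr0n//.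
have s1 : 1 <= Num.sqrt k%:R :> R by rewrite -[leLHS]sqrtr1 ler_sqrt ?ltr0n.
by rewrite -[leLHS]mulr1 ler_pM.
Qed.

Lemma root34_sqr k : root34 k ^+ 2 = k%:R * Num.sqrt k%:R :> R.
Proof. by rewrite sqr_sqrtr// mulr_ge0 ?sqrtr_ge0. Qed.

Lemma root34S k : (0 < k)%N -> root34 k.+1 <= root34 k + 1 :> R.
Proof.
move=> k0; have b0 := root34_gt0 k0.
rewrite -(@ler_pXn2r _ 2)// ?nnegrE ?sqrtr_ge0 ?addr_ge0 ?(ltW b0)//.
rewrite root34_sqr.
pose s : R := Num.sqrt k%:R; pose t : R := Num.sqrt k.+1%:R.
have s2 : s ^+ 2 = k%:R by rewrite sqr_sqrtr.
have b2 : root34 k ^+ 2 = s ^+ 2 * s by rewrite root34_sqr s2.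
have t2 : t ^+ 2 = s ^+ 2 + 1 by rewrite sqr_sqrtr// s2 -natr1.
have s1 : 1 <= s by rewrite -sqrtr1 ler_sqrt ?ltr01// ?ler1n// ltr0n.
have t0 : 0 <= t by exact: sqrtr_ge0.
have bs : s <= root34 k.
  rewrite -(@ler_pXn2r _ 2)// ?nnegrE ?(ltW b0) ?(le_trans ler01)// b2.
  by rewrite ler_peMr// sqr_ge0.
(* The tangent of the square root at [k]. The excess over [s ^+ 2 * s] is then at most
   [s / 2 + s + 1 / 2], which [2 * root34 k + 1] dominates because [root34 k >= s]. *)
have ts : t <= s + (2 * s)^-1.
  have i0 : 0 < (2 * s)^-1 by rewrite invr_gt0 mulr_gt0// (lt_le_trans ltr01).
  rewrite -(@ler_pXn2r _ 2)// ?nnegrE ?addr_ge0 ?(ltW i0) ?(le_trans ler01)// t2.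
  have : 2 * s * (2 * s)^-1 = 1.
    by rewrite mulfV// mulf_neq0 ?pnatr_eq0// gt_eqF// (lt_le_trans ltr01).
  move: ((2 * s)^-1) i0 => i i0 si; nra.
have -> : k.+1%:R * Num.sqrt k.+1%:R = (s ^+ 2 + 1) * t by rewrite s2 natr1.
rewrite sqrrD b2.
have : s * (2 * s)^-1 = 2^-1.
  by rewrite invfM mulrCA mulfV ?mulr1// gt_eqF// (lt_le_trans ltr01).
have : (2 * s)^-1 <= 2^-1.
  have s0 : 0 < s by rewrite (lt_le_trans ltr01).
  by rewrite lef_pV2 ?posrE ?mulr_gt0// ler_peMr.
move: ts bs s1; move: ((2 * s)^-1) (root34 k) => i b ts bs s1 i2 si.
have h : (s ^+ 2 + 1) * t <= (s ^+ 2 + 1) * (s + i).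
  by rewrite ler_wpM2l// addr_ge0 ?sqr_ge0.
apply: (le_trans h).
have -> : (s ^+ 2 + 1) * (s + i) = s ^+ 2 * s + s * (s * i) + s + i by ring.
rewrite si; lra.
Qed.

Lemma root34_powR k : root34 k = k%:R `^ (3 / 4) :> R.
Proof.
rewrite /root34 -!powR12_sqrt// ?mulr_ge0 ?powR_ge0//.
rewrite -[X in X * _]powRr1// -powRD; last first.
  by apply/implyP => /eqP h; exfalso; move: h; lra.
by rewrite -powRrM; congr (_ `^ _); field.
Qed.

End root34.

(* The logarithmic factor is at most a multiple of [k `^ (1 / 8)], and
   [3 / 4 + 1 / 8 < 1]. *)
Lemma log_increment_le (R : realType) (q : R) : 0 <= q ->
  exists k0 : nat, forall k L, (k0 <= k)%N -> 0 <= L -> L <= 4 * ln k.+1%:R ->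
    3 / 2 * (L * (1 + L) `^ q / k.+1%:R) <= (2 * root34 k)^-1.
Proof.
(* The product of [L] and the [q]-th power of [1 + L] is at most the power [q + 1] of [1 + L]; this
   [e] turns the logarithm in it into the eighth root of [k + 1], up to the factor [D]. *)
move=> q0; pose e : R := (8 * (q + 1))^-1.
have q1 : 0 < q + 1 by rewrite ltr_wpDl.
have e0 : 0 < e by rewrite invr_gt0 mulr_gt0.
pose D := (1 + 4 / e) `^ (q + 1).
(* Hence [3 * D] is at most another eighth root of [k + 1], and the exponents 1/8, 1/8 and 3/4 add
   up to 1. The 3 is [3 / 2] times the 2 in front of [root34]. *)
have [k0 hk0] : exists k0 : nat, (3 * D) ^+ 8 <= k0%:R.
  exists (Num.bound ((3 * D) ^+ 8)).
  by rewrite ltW// archi_boundP// exprn_ge0// mulr_ge0 ?powR_ge0.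
exists k0.+1 => k L kk0 L0 L4.
have k_gt0 : (0 < k)%N by exact: leq_trans kk0.
pose y : R := k.+1%:R.
have y1 : 1 <= y by rewrite ler1n.
have y0 : 0 < y by rewrite ltr0n.
have ye1 : 1 <= y `^ e.
  exact: powR_ge1 (ltW e0) y1.
have L1 : 1 + L <= (1 + 4 / e) * y `^ e.
  have := ln_powR_bound e0 y1.
  rewrite mulrDl mul1r => h; rewrite lerD// (le_trans L4)//.
  by rewrite -mulrA ler_wpM2l// mulrC.
have hL : L * (1 + L) `^ q <= D * y `^ 8^-1.
  apply: (@le_trans _ _ ((1 + L) `^ (q + 1))).
    rewrite powRD; last by rewrite gt_eqF ?implybT// ltr_wpDr.
    by rewrite powRr1 ?addr_ge0// mulrC ler_wpM2l ?powR_ge0// lerDr.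
  have -> : 8^-1 = e * (q + 1) :> R.
    by rewrite /e invfM -mulrA mulVf ?mulr1// gt_eqF.
  rewrite powRrM -powRM ?powR_ge0 ?addr_ge0 ?divr_ge0 ?(ltW e0)//.
  rewrite ge0_ler_powR ?nnegrE ?(ltW q1) ?addr_ge0//.
  by rewrite mulr_ge0 ?powR_ge0 ?addr_ge0 ?divr_ge0 ?(ltW e0).
have b0 : 0 < root34 k :> R by exact: root34_gt0.
have bk : root34 k <= y `^ (3 / 4).
  by rewrite root34_powR ge0_ler_powR ?nnegrE ?divr_ge0 ?ler0n// ler_nat.
have hD : 3 * D <= y `^ 8^-1.
  have -> : 3 * D = ((3 * D) ^+ 8) `^ 8^-1.
    by rewrite -powR_mulrn ?mulr_ge0 ?powR_ge0// -powRrM mulfV ?powRr1 ?mulr_ge0 ?powR_ge0.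
  rewrite ge0_ler_powR ?nnegrE ?exprn_ge0 ?mulr_ge0 ?powR_ge0 ?(ltW y0)//.
  by rewrite (le_trans hk0)// ler_nat (leq_trans _ (leqW kk0)).
rewrite -[leRHS]mul1r ler_pdivlMr ?mulr_gt0//.
have -> : 3 / 2 * (L * (1 + L) `^ q / y) * (2 * root34 k) =
  (3 * (L * (1 + L) `^ q) * root34 k) / y.
  by field; rewrite gt_eqF.
rewrite ler_pdivrMr// mul1r.
apply: (@le_trans _ _ (3 * (D * y `^ 8^-1) * y `^ (3 / 4))).
  apply: ler_pM => //.
  - by rewrite !mulr_ge0 ?powR_ge0.
  - exact: ltW.
  - by rewrite ler_wpM2l.
apply: (@le_trans _ _ (y `^ 8^-1 * y `^ 8^-1 * y `^ (3 / 4))).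
  by rewrite ler_wpM2r ?powR_ge0// mulrA ler_wpM2r ?powR_ge0.
have yn0 : y != 0 by rewrite gt_eqF.
rewrite -!powRD ?yn0 ?implybT//.
have -> : 8^-1 + 8^-1 + 3 / 4 = 1 :> R by field.
by rewrite powRr1 ?(ltW y0).
Qed.

(** * Regularity of the hazard and of the tail *)

Section regularity.
Context {R : realType}.
Variables (F : R -> R) (alpha : R).
Hypothesis alpha_gt0 : 0 < alpha.
Hypothesis F_lt1 : forall x, F x < 1.
Hypothesis F_G : stretched_exponential alpha F.

Lemma hazard_increments : exists2 K : R, 1 <= K & forall u v, K < u -> u < v ->
  [/\ (v `^ alpha - u `^ alpha) / 2 <= hazard F v - hazard F u &
      hazard F v - hazard F u <= 3 / 2 * (v `^ alpha - u `^ alpha)].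
Proof.
have [x0 [x0_ge0 _ [h [hE hd _ h']]]] := F_G.
have a2 : 0 < alpha / 2 by rewrite divr_gt0.
move/cvgrPdist_lt : h' => /(_ _ a2)[M [_ hM]].
pose K := Num.max 1 (Num.max x0 M).
have K1 : 1 <= K by rewrite le_max lexx.
have Kx0 : x0 <= K by rewrite !le_max lexx orbT.
have KM : M <= K by rewrite !le_max lexx !orbT.
have K0 : 0 < K by rewrite (lt_le_trans ltr01).
exists K => // u v Ku uv.
have h'le x : K < x -> `|derive1 h x| <= alpha / 2 * x `^ (alpha - 1).
  move=> Kx; have := hM x (le_lt_trans KM Kx).
  rewrite sub0r normrN normrM normfV (gtr0_norm (powR_gt0 _ _)); last exact: lt_trans Kx.
  by rewrite ltr_pdivrMr ?powR_gt0 ?(lt_trans K0)// => /ltW.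
(* Half of the leading power dominates [h] in derivative, so [g s] is nondecreasing beyond [K] for
   both signs [s]: [s = 1] yields the lower bound and [s = -1] the upper one. *)
pose g (s x : R) := 2^-1 * x `^ alpha + s * h x.
have dg s x : K < x ->
    is_derive x 1 (g s) (2^-1 * (alpha * x `^ (alpha - 1)) + s * derive1 h x).
  move=> Kx; have x_gt0 : 0 < x by exact: lt_trans Kx.
  have d1 := is_derive1_powR alpha x_gt0.
  have d2 : is_derive x 1 h (derive1 h x).
    by rewrite derive1E; apply/derivableP; have [] := hd x (le_lt_trans Kx0 Kx).
  by apply: is_deriveD; apply: is_deriveZ.
have mono s : `|s| = 1 -> 0 <= g s v - g s u.
  move=> s1; have [||x] := @MVT R (g s)
    (fun x => 2^-1 * (alpha * x `^ (alpha - 1)) + s * derive1 h x) u v uv.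
  - by move=> x; rewrite in_itv/= => /andP[ux _]; apply: dg; exact: lt_trans ux.
  - apply: derivable_within_continuous => x; rewrite in_itv/= => /andP[ux _].
    by have [] := dg s x (lt_le_trans Ku ux).
  rewrite in_itv/= => /andP[ux _] ->; rewrite mulr_ge0 ?subr_ge0 ?(ltW uv)//.
  have := h'le x (lt_trans Ku ux).
  have : `|s * derive1 h x| = `|derive1 h x| by rewrite normrM s1 mul1r.
  move=> <-; rewrite ler_norml; lra.
have mp := mono 1 (normr1 _).
have mm : 0 <= g (-1) v - g (-1) u by apply: mono; rewrite normrN1.
have Kv := lt_trans Ku uv.
rewrite !hE ?(le_lt_trans Kx0)//.
by move: mp mm; rewrite /g; split; lra.
Qed.

Lemma survivalE x : 1 - F x = expR (- hazard F x).
Proof. by rewrite /hazard opprK lnK// posrE subr_gt0. Qed.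

(** The tail bound on [x] limits the hazard increment to [2 * ln (k + 1)], hence the increment of
    the power [alpha] to [4 * ln (k + 1)]. Moving only the fraction [1 / (k + 1)] of the way scales
    this down up to logarithms; the result returns to the hazard with the factor [3 / 2], and
    [exp (- z) >= 1 - z] concludes. *)
Lemma survival_step : exists (K : R) (k0 : nat), forall m x k,
  K < m -> (k0 <= k)%N -> m < x -> (1 - F m) * gap k <= 1 - F x ->
  (1 - F m) * (1 - (2 * root34 k)^-1) <= 1 - F (m + (x - m) / k.+1%:R).
Proof.
have [K K1 hK] := hazard_increments.
have q0 : 0 <= `|alpha - 1| / alpha by rewrite divr_ge0// ltW.
have [k0 hk0] := log_increment_le q0.
exists K, k0.+1 => m x k Km kk0 mx hx.
have k_gt0 : (0 < k)%N by exact: leq_trans kk0.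
have m1 : 1 <= m by rewrite (le_trans K1)// ltW.
have m0 : 0 <= m by rewrite (le_trans ler01).
have sf0 y : 0 < 1 - F y by rewrite subr_gt0.
have gapE : gap k = (k%:R * k.+1%:R)^-1 :> R.
  have n0 : k%:R != 0 :> R by rewrite pnatr_eq0 -lt0n.
  have n1 : k%:R + 1 != 0 :> R by rewrite natr1 pnatr_eq0.
  by rewrite /gap -natr1; field; rewrite ?n0 ?n1.
have gap0 : 0 < gap k :> R by rewrite gapE invr_gt0 mulr_gt0 ?ltr0n.
have hH : hazard F x - hazard F m <= 2 * ln k.+1%:R.
  have : ln ((1 - F m) * gap k) <= ln (1 - F x).
    by rewrite ler_ln ?posrE ?mulr_gt0 ?sf0.
  rewrite lnM ?posrE ?sf0// gapE lnV ?posrE ?mulr_gt0 ?ltr0n//.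
  rewrite lnM ?posrE ?ltr0n// /hazard.
  have : ln k%:R <= ln k.+1%:R :> R by rewrite ler_ln ?posrE ?ltr0n// ler_nat.
  lra.
have [h1 _] := hK m x Km mx.
pose L := x `^ alpha - m `^ alpha.
have L0 : 0 <= L.
  rewrite subr_ge0 ge0_ler_powR ?nnegrE ?(ltW alpha_gt0) ?(ltW mx)//.
  by rewrite (le_trans m0)// ltW.
have L4 : L <= 4 * ln k.+1%:R by rewrite /L; lra.
have := hk0 k L (ltnW kk0) L0 L4.
have := @powR_increment_le R alpha m x L k.+1 alpha_gt0 m1 mx isT erefl.
have mm' : m < m + (x - m) / k.+1%:R by rewrite ltrDl divr_gt0 ?subr_gt0 ?ltr0n.
have [_ h2] := hK _ _ Km mm'.
rewrite !survivalE => h3 h4.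
set m' := m + _ in mm' h2 h3 *.
have -> : - hazard F m' = - hazard F m + - (hazard F m' - hazard F m) by lra.
rewrite expRD ler_wpM2l ?expR_ge0// (le_trans _ (expR_ge1Dx _))//.
move: h2 h3 h4; move: (L * _ / _) => z; lra.
Qed.

End regularity.

(** * The retained values along one sequence of observations *)

Lemma cvgn_bounded (R : realType) (u : nat -> R) :
  cvgn u -> exists M, forall n, `|u n| <= M.
Proof.
move=> /cvg_seq_bounded[M [_ hM]]; exists (M + 1) => n.
by apply: (hM (M + 1)) => //; rewrite ltrDl.
Qed.

Lemma harmonic_unbounded (R : realType) (A : R) :
  exists n, A < \sum_(i < n) i.+2%:R^-1.
Proof.
apply: contrapT => /forallNP h; apply: (@dvg_harmonic R).
apply: nondecreasing_is_cvgn.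
  by apply: nondecreasing_series => i _ _; rewrite invr_ge0.
exists (1 + A) => _ [[|n] _ <-].
  have A0 : 0 <= A.
    by rewrite leNgt; apply/negP; have := h 0%N; rewrite big_ord0.
  by rewrite /series/= big_geq// addr_ge0.
rewrite /series/= big_mkord big_ord_recl invr1 lerD2l.
by rewrite leNgt; apply/negP; exact: h.
Qed.

Lemma cvgn_sum_tail (R : realType) (u v : nat -> R) n0 :
  (forall i, (n0 <= i)%N -> u i = v i) ->
  cvgn (fun n => \sum_(i < n) u i) -> cvgn (fun n => \sum_(i < n) v i).
Proof.
move=> uv /cvg_ex[l ul]; apply/cvg_ex.
pose C := \sum_(i < n0) v i - \sum_(i < n0) u i; exists (l + C).
apply: (@cvg_trans _ ((fun n => \sum_(i < n) u i + C) @ \oo)); last first.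
  by apply: cvgD => //; exact: cvg_cst.
apply: near_eq_cvg; exists n0 => // n /= n0n.
rewrite -!(big_mkord predT) !(big_cat_nat (leq0n n0) n0n)/=.
have -> : \sum_(n0 <= i < n) u i = \sum_(n0 <= i < n) v i.
  by apply: eq_big_nat => i /andP[ni _]; exact: uv.
by rewrite /C -!(big_mkord predT); ring.
Qed.

Section record_process.
Context {R : realType}.
Variables (F : R -> R) (x : nat -> R).

(* [(k, m, s)] after observation [n]: [k] values retained, with mean [m], and the
   sum [s] of [(1 - F _)^-1] over the first [k] means, the current one included. *)
Fixpoint state (n : nat) : nat * R * R :=
  if n is p.+1 then
    let: (k, m, s) := state p in
    if m < x p.+1 then
      let m' := m + (x p.+1 - m) / k.+1%:R in (k.+1, m', s + (1 - F m')^-1)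
    else (k, m, s)
  else (1%N, x 0%N, (1 - F (x 0%N))^-1).

Definition cnt n := (state n).1.1.
Definition avg n := (state n).1.2.
Definition wsum n := (state n).2.
Definition kept n := avg n < x n.+1.
Definition weight n := (1 - F (avg n))^-1.

Lemma cntS n : cnt n.+1 = (cnt n + kept n)%N.
Proof.
rewrite /cnt /kept /avg /=; case: (state n) => -[k m] s /=.
by case: ifP; rewrite /= ?addn1 ?addn0.
Qed.

Lemma avgS n : avg n.+1 =
  if kept n then avg n + (x n.+1 - avg n) / (cnt n).+1%:R else avg n.
Proof.
rewrite /cnt /kept /avg /=; case: (state n) => -[k m] s /=.
by case: ifP.
Qed.

Lemma wsumS n : wsum n.+1 = wsum n + (kept n)%:R * weight n.+1.
Proof.
rewrite /weight /wsum /kept /avg /=; case: (state n) => -[k m] s /=.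
by case: ifP; rewrite /= ?mul1r// mul0r addr0.
Qed.

Lemma cnt_gt0 n : (0 < cnt n)%N.
Proof. by elim: n => // n IH; rewrite cntS addn_gt0 IH. Qed.

Lemma cnt_le n : (cnt n <= n.+1)%N.
Proof.
elim: n => // n IH; rewrite cntS -(addn1 n.+1).
by apply: leq_add => //; case: kept.
Qed.

Lemma avg_leS n : avg n <= avg n.+1.
Proof.
rewrite avgS; case: ifP => // h; rewrite lerDl divr_ge0 ?ler0n//.
by rewrite subr_ge0 ltW.
Qed.

Lemma avg_nd i j : (i <= j)%N -> avg i <= avg j.
Proof.
move=> /subnKC <-; elim: (j - i)%N => [|k IH]; first by rewrite addn0.
by rewrite addnS (le_trans IH)// avg_leS.
Qed.

Lemma cnt_nd i j : (i <= j)%N -> (cnt i <= cnt j)%N.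
Proof.
move=> /subnKC <-; elim: (j - i)%N => [|k IH]; first by rewrite addn0.
by rewrite addnS (leq_trans IH)// cntS leq_addr.
Qed.

Lemma weight_unkept n : ~~ kept n -> weight n.+1 = weight n.
Proof. by rewrite /weight avgS => /negbTE ->. Qed.

(** A retention contributes the weight of the mean about to be replaced, so the sum covers every
    mean but the current one. *)
Lemma sum_kept_weight n : \sum_(i < n) (kept i)%:R * weight i = wsum n - weight n.
Proof.
elim: n => [|n IH]; first by rewrite big_ord0 subrr.
rewrite big_ord_recr /= IH wsumS; have [k|/weight_unkept ->] := boolP (kept n).
  by rewrite !mul1r subrK addrK.
by rewrite !mul0r !addr0.
Qed.

Lemma sum_kept_telescope (psi : nat -> R) n :
  \sum_(i < n) (kept i)%:R * (psi (cnt i) - psi (cnt i).+1) = psi 1%N - psi (cnt n).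
Proof.
elim: n => [|n IH]; first by rewrite big_ord0 subrr.
rewrite big_ord_recr /= IH cntS; case: (kept n).
  by rewrite mul1r addn1 addrA subrK.
by rewrite mul0r addn0 addr0.
Qed.

Hypothesis F_ge0 : forall y, 0 <= F y.
Hypothesis F_lt1 : forall y, F y < 1.

Lemma weight_ge1 n : 1 <= weight n.
Proof.
have h : 0 < 1 - F (avg n) by rewrite subr_gt0.
by rewrite -[X in X <= _]invr1 lef_pV2 ?posrE// gerBl.
Qed.

Lemma weight_gt0 n : 0 < weight n.
Proof. exact: lt_le_trans ltr01 (weight_ge1 n). Qed.

Lemma wsum_leS n : wsum n <= wsum n.+1.
Proof. by rewrite wsumS lerDl mulr_ge0// ltW// weight_gt0. Qed.

Lemma wsum_ge_cnt n : (cnt n)%:R <= wsum n.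
Proof.
elim: n => [|n IH]; first exact: (weight_ge1 0).
rewrite cntS wsumS natrD lerD//; case: kept; rewrite ?mul0r// mul1r.
exact: weight_ge1.
Qed.

Lemma wsum_gt0 n : 0 < wsum n.
Proof. by rewrite (lt_le_trans _ (wsum_ge_cnt n))// ltr0n cnt_gt0. Qed.

Lemma weight_le_wsum n : weight n <= wsum n.
Proof.
elim: n => // n IH; rewrite wsumS.
have [k|/weight_unkept ->] := boolP (kept n); last by rewrite mul0r addr0.
by rewrite mul1r lerDr ltW// wsum_gt0.
Qed.

(** * Divergence of the retained means and counts *)

Section divergence.
Hypothesis exceed_cvg : forall K : nat, cvgn (fun n =>
  \sum_(i < n) i.+2%:R^-1 * ((K%:R < x i.+1)%R%:R - (1 - F K%:R))).

(** The centred sums converge, hence stay bounded, while the centring is [1 - F K%:R] times a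
    divergent harmonic sum. *)
Lemma exceed_sum_unbounded (A : R) (K : nat) :
  exists n, A < \sum_(i < n) i.+2%:R^-1 * (K%:R < x i.+1)%R%:R.
Proof.
apply: contrapT => /forallNP h.
have hA n : \sum_(i < n) i.+2%:R^-1 * (K%:R < x i.+1)%R%:R <= A.
  by rewrite leNgt; apply/negP; exact: h.
have [M hM] := cvgn_bounded (@exceed_cvg K).
have q0 : 0 < 1 - F K%:R by rewrite subr_gt0.
have [n] := harmonic_unbounded ((A + M) / (1 - F K%:R)).
apply/negP; rewrite -leNgt ler_pdivlMr//.
have := hM n; rewrite ler_norml => /andP[+ _].
under eq_bigr do rewrite mulrBr.
rewrite sumrB -mulr_suml; have := hA n; lra.
Qed.

Lemma exceed_io n (K : nat) : exists2 i, (n < i)%N & K%:R < x i.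
Proof.
apply: contrapT => h.
have {}h i : (n < i)%N -> (K%:R < x i) = false.
  by move=> ni; apply/negP => Ki; apply: h; exists i.
have [N] := exceed_sum_unbounded n%:R K.
(* Only the first [n] terms can be nonzero, and each is at most 1. *)
apply/negP; rewrite -leNgt (@le_trans _ _ (minn N n)%:R)//; last first.
  by rewrite ler_nat geq_minr.
elim: N => [|N IH]; first by rewrite big_ord0.
rewrite big_ord_recr/=; have [nN|Nn] := leqP n N.
  rewrite h// mulr0 addr0 (le_trans IH)// ler_nat.
  by rewrite leq_min geq_minr andbT (leq_trans (geq_minl _ _)).
have -> : minn N.+1 n = (minn N n).+1 by lia.
rewrite -[leRHS]natr1 lerD//; case: (_ < _); rewrite ?mulr0// mulr1.
by rewrite invf_le1 ?ltr0n// ler1n.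
Qed.

(** If the means stayed below [K], every observation above [K + 1] would be retained and raise the
    mean by at least [1 / (cnt n + 1)], hence by [1 / (n + 2)] since [cnt n <= n + 1]. This is where
    the harmonic coefficients come from. *)
Lemma avg_unbounded (K : nat) : exists n, K%:R < avg n.
Proof.
apply: contrapT => /forallNP h.
have hK n : avg n <= K%:R by rewrite leNgt; apply/negP; exact: h.
have lb n : avg 0 + \sum_(i < n) i.+2%:R^-1 * (K.+1%:R < x i.+1)%R%:R <= avg n.
  elim: n => [|n IH]; first by rewrite big_ord0 addr0.
  rewrite big_ord_recr/= addrA; case: ltP => Kx; last first.
    by rewrite mulr0 addr0 (le_trans IH)// avg_leS.
  have kn : kept n by rewrite /kept (le_lt_trans (hK n))// (lt_trans _ Kx)// ltr_nat.
  rewrite avgS kn lerD// mulr1.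
  rewrite -[X in X <= _]mul1r ler_pM ?invr_ge0//.
    by move: Kx (hK n); rewrite -natr1; lra.
  by rewrite lef_pV2 ?posrE ?ltr0n// ler_nat ltnS cnt_le.
have [n hn] := exceed_sum_unbounded (K%:R - avg 0) K.+1.
by have := lb n; have := hK n; move: hn; lra.
Qed.

Lemma state_run n l : (n <= l)%N ->
  (forall j, (n < j <= l)%N -> (avg n < x j) = false) -> state l = state n.
Proof.
move=> /subnKC <-; elim: (l - n)%N => [|k IH] h; first by rewrite addn0.
have e : state (n + k) = state n.
  by apply: IH => j /andP[nj jk]; apply: h; rewrite nj addnS leqW.
have := h (n + k).+1; rewrite addnS /= e leqnn andbT ltnS leq_addr /avg.
by case: (state n) => -[c m] s /= ->.
Qed.

(** The selection rule counts observations from 1: [state n] is the situation after observation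
    number [n.+1], and [kept l] retains [x l.+1], which has number [l.+2]. *)
Lemma next_kept n : exists l, [/\ (n <= l)%N, state l = state n, kept l &
  first_exceed (fun i => x i.-1) n.+1 (avg n) = Some l.+2].
Proof.
have ex : exists i, (n.+1 < i)%N && (avg n < x i.-1).
  have [K hK] : exists K : nat, avg n <= K%:R.
    exists (Num.bound `|avg n|).
    by rewrite (le_trans (ler_norm _))// ltW// archi_boundP.
  have [i ni Ki] := exceed_io n K; exists i.+1 => /=.
  by rewrite ltnS ni (le_lt_trans hK).
rewrite /first_exceed; case: pselect => // ex'.
case: ex_minnP => -[//|[//|l]] /andP[nl hl] hmin; exists l.
have nl' : (n <= l)%N by [].
have e : state l = state n.
  apply: state_run => // j /andP[nj jl]; apply/negP => hj.
  have := hmin j.+1; rewrite ltnS nj/= hj => /(_ isT).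
  by rewrite ltnS ltnNge jl.
by split => //; rewrite /kept /avg e.
Qed.

Lemma cnt_unbounded A : exists n, (A <= cnt n)%N.
Proof.
elim: A => [|A [n hn]]; first by exists 0%N.
have [l [_ e kl _]] := next_kept n; exists l.+1.
by rewrite cntS kl addn1 ltnS /cnt e.
Qed.

Let y i := x i.-1.

(** A dictionary between the recursion over retentions and the one over observations. The
    denominator of the ratio stops before the current mean, hence [wsum n - weight n]; the last
    clause exposes the retention that produced [state n]. *)
Lemma retention_state k : exists n ys,
  [/\ retention 1 y k = (Some n.+1, ys), size ys = k.+1, mean ys = avg n,
      cnt n = k.+1 /\
      wsum n - weight n =
        \sum_(1 <= j < k.+1) (1 - F (ret_mean 1 y j))^-1 &
      (0 < k)%N -> exists2 p, n = p.+1 & kept p].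
Proof.
elim: k => [|k [n [ys [rk sk mk [ck wk] _]]]].
  exists 0%N, [:: x 0%N]; split => //.
    by rewrite /mean big_seq1 divr1.
  by rewrite big_geq// subrr.
have [l [nl e kl fe]] := next_kept n.
have [el1 el2 el3] : [/\ cnt l = cnt n, avg l = avg n & wsum l = wsum n].
  by rewrite /cnt /avg /wsum e.
exists l.+1, (rcons ys (x l.+1)).
have rk' : retention 1 y k.+1 = (Some l.+2, rcons ys (x l.+1)).
  by rewrite /= rk /= mul1r mk fe.
split => //.
- by rewrite size_rcons sk.
- rewrite avgS kl el1 el2 ck -mk /mean size_rcons sk.
  rewrite -cats1 big_cat big_seq1/=.
  have n1 : k.+1%:R != 0 :> R by rewrite pnatr_eq0.
  have n2 : k.+2%:R = k.+1%:R + 1 :> R by rewrite natr1.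
  have n3 : k.+1%:R + 1 != 0 :> R by rewrite natr1 pnatr_eq0.
  rewrite n2; move: n1 n3; move: (k.+1%:R : R) => z n1 n3.
  by field; rewrite ?n1 ?n3.
- split; first by rewrite cntS kl el1 ck addn1.
  rewrite wsumS kl mul1r addrK el3 big_nat_recr//= -wk.
  have -> : ret_mean 1 y k.+1 = avg n by rewrite /ret_mean /= rk /= mk.
  by rewrite -/(weight n) subrK.
- by move=> _; exists l.
Qed.

Lemma ret_ratio_kept k : (1 < k)%N -> exists p,
  [/\ kept p, (k <= p.+2)%N &
      ret_ratio F 1 y k = (p.+2%:R / wsum p)%:E].
Proof.
case: k => [//|[//|k]] _.
have [n [ys [rk _ _ [ck wk] /(_ isT)[p np kp]]]] := retention_state k.+1.
exists p; split => //.
  by rewrite -ck np cnt_le.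
rewrite /ret_ratio /ret_time rk /= -wk np -EFinM.
by rewrite wsumS kp mul1r addrK.
Qed.

(** * Growth of the weights and the limit of the ratio *)

Section ratio.
Hypothesis step : exists (K : R) (k0 : nat), forall m z k,
  K < m -> (k0 <= k)%N -> m < z -> (1 - F m) * gap k <= 1 - F z ->
  (1 - F m) * (1 - (2 * root34 k)^-1) <= 1 - F (m + (z - m) / k.+1%:R).
Hypothesis moderate : exists i0, forall i, (i0 <= i)%N -> kept i ->
  (1 - F (avg i)) * gap (cnt i) <= 1 - F (x i.+1).

(** At a retention [v = wsum p / weight p] is multiplied by at least [1 - (2 * b)^-1], where
    [b = root34 (cnt p)], and then increased by 1. From [v >= c * b] the new value is at least
    [c * b - c / 2 + 1], hence at least [c * (b + 1)]. *)
Lemma wsum_weight_ratio : exists (c : R) (n0 : nat), 0 < c /\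
  forall n, (n0 <= n)%N -> c * root34 (cnt n) <= wsum n / weight n.
Proof.
have [K [k0 hstep]] := step; have [i0 hmod] := moderate.
have [K' hK'] : exists K' : nat, K <= K'%:R.
  exists (Num.bound `|K|).
  by rewrite (le_trans (ler_norm _))// ltW// archi_boundP.
have [n1 hn1] := avg_unbounded K'; have [n2 hn2] := cnt_unbounded k0.
pose n0 := maxn i0 (maxn n1 n2).
have b0 n : 0 < root34 (cnt n) :> R by rewrite root34_gt0// cnt_gt0.
(* The bound [2^-1] carries the induction; the other one starts it, since [wsum] is at least
   [weight]. *)
pose c : R := Num.min (2^-1) (root34 (cnt n0))^-1.
have c0 : 0 < c by rewrite lt_min !invr_gt0 b0 ltr0n.
have c2 : c <= 2^-1 by rewrite ge_min lexx.
exists c, n0; split => // n /subnKC <-.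
elim: (n - n0)%N => [|k IH].
  rewrite addn0 (@le_trans _ _ 1)//; last first.
    by rewrite ler_pdivlMr ?weight_gt0// mul1r weight_le_wsum.
  by rewrite -ler_pdivlMr// mul1r ge_min lexx orbT.
rewrite addnS; set p := (n0 + k)%N in IH *.
have n0p : (n0 <= p)%N by exact: leq_addr.
have w0 := weight_gt0 p; have w1 := weight_gt0 p.+1; have s0 := wsum_gt0 p.
have [kp|kp] := boolP (kept p); last first.
  by rewrite wsumS cntS (weight_unkept kp) (negbTE kp) mul0r addr0 addn0.
rewrite wsumS kp mul1r cntS kp addn1 mulrDl mulfV ?gt_eqF//.
have hs : (1 - F (avg p)) * (1 - (2 * root34 (cnt p))^-1) <= 1 - F (avg p.+1).
  rewrite avgS kp; apply: hstep => //.
  - rewrite (le_lt_trans hK')// (lt_le_trans hn1)// avg_nd//.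
    by rewrite (leq_trans _ n0p)// !leq_max leqnn orbT.
  - by rewrite (leq_trans hn2)// cnt_nd// (leq_trans _ n0p)// !leq_max leqnn !orbT.
  - by apply: hmod => //; rewrite (leq_trans _ n0p)// leq_max leqnn.
have b1 : 1 <= root34 (cnt p) :> R by rewrite root34_ge1// cnt_gt0.
have bS : root34 (cnt p).+1 <= root34 (cnt p) + 1 :> R by rewrite root34S// cnt_gt0.
have hv : wsum p / weight p * (1 - (2 * root34 (cnt p))^-1) <= wsum p / weight p.+1.
  by rewrite -mulrA ler_wpM2l ?(ltW s0)// /weight !invrK.
move: IH hv bS b1; move: (root34 _) (wsum p / _) (wsum p / _) (root34 _) => b' v' v b.
move=> IH hv bS b1.
have bgt0 : 0 < b by rewrite (lt_le_trans ltr01).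
have e : b * (2 * b)^-1 = 2^-1 by rewrite invfM mulrCA mulfV ?mulr1// gt_eqF.
have t0 : 0 <= 1 - (2 * b)^-1.
  rewrite subr_ge0 invf_le1 ?mulr_gt0//; lra.
have h1 : c * b * (1 - (2 * b)^-1) <= v * (1 - (2 * b)^-1) by rewrite ler_wpM2r.
have h2 : c * b * (1 - (2 * b)^-1) = c * b - c / 2 by rewrite mulrBr mulr1 -mulrA e.
have h3 : c * b' <= c * (b + 1) by rewrite ler_wpM2l// ltW.
move: h1 h2 h3 hv c2 c0; lra.
Qed.

Definition rgap (k : nat) : R := (Num.sqrt k%:R)^-1 - (Num.sqrt k.+1%:R)^-1.

Lemma rgap_ge k : (0 < k)%N -> (root34 k ^+ 2)^-1 <= 6 * rgap k.
Proof.
move=> k0; rewrite root34_sqr /rgap.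
pose s : R := Num.sqrt k%:R; pose t : R := Num.sqrt k.+1%:R.
have s2 : s ^+ 2 = k%:R by rewrite sqr_sqrtr.
have t2 : t ^+ 2 = s ^+ 2 + 1 by rewrite sqr_sqrtr// s2 natr1.
have s1 : 1 <= s by rewrite -sqrtr1 ler_sqrt ?ltr01// ?ler1n// ltr0n.
have t0 : 0 < t by rewrite sqrtr_gt0 ltr0n.
have s0 : 0 < s by rewrite (lt_le_trans ltr01).
rewrite -/s -/t -s2.
have -> : 6 * (s^-1 - t^-1) = 6 * (t - s) / t / s.
  by field; rewrite !gt_eqF.
have -> : (s ^+ 2 * s)^-1 = (s ^+ 2)^-1 * s^-1 by rewrite invfM.
rewrite ler_wpM2r ?invr_ge0 ?(ltW s0)//.
rewrite ler_pdivlMr// mulrC ler_pdivrMr ?exprn_gt0//.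
(* The constant 6 is 2 times 3: [t <= 2 * s] and, from [(t - s) * (t + s) = 1], also
   [t - s >= 1 / (3 * s)]. *)
have ts : t <= 2 * s.
  by rewrite -(@ler_pXn2r _ 2)// ?nnegrE ?mulr_ge0 ?ltW// t2; nra.
have st : s < t by rewrite -(@ltr_pXn2r _ 2)// ?nnegrE ?ltW// t2 ltrDl.
have d : (t - s) * (t + s) = 1 by rewrite -subr_sqr t2 addrAC subrr add0r.
have h : 1 <= (t - s) * (3 * s) by rewrite -[leLHS]d ler_wpM2l ?subr_ge0 ?(ltW st)//; lra.
have := ler_wpM2r (ltW s0) h; nra.
Qed.

(** The constant [c] depends on the observations; rounding [6 / c ^+ 2] up to a natural number
    leaves countably many cut-off levels. *)
Lemma weight_ratio_sqr : exists (N n0 : nat), forall n, (n0 <= n)%N ->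
  (weight n / wsum n) ^+ 2 <= N%:R * rgap (cnt n).
Proof.
have [c [n0 [c0 h]]] := wsum_weight_ratio.
exists (Num.bound (6 / c ^+ 2)), n0 => n /h hn.
have b0 : 0 < root34 (cnt n) :> R by rewrite root34_gt0// cnt_gt0.
have cb : 0 < c * root34 (cnt n) by rewrite mulr_gt0.
have -> : weight n / wsum n = (wsum n / weight n)^-1 by rewrite invf_div.
have h1 : (wsum n / weight n)^-1 ^+ 2 <= (c * root34 (cnt n))^-1 ^+ 2.
  rewrite ler_pXn2r// ?nnegrE ?invr_ge0 ?(ltW cb)//; last first.
    by rewrite (le_trans (ltW cb)).
  by rewrite lef_pV2 ?posrE// (lt_le_trans cb).
apply: (le_trans h1); rewrite exprVn exprMn invfM.
have rg := rgap_ge (cnt_gt0 n).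
have rg0 : 0 <= rgap (cnt n).
  have : 0 <= 6 * rgap (cnt n) by rewrite (le_trans _ rg)// invr_ge0 sqr_ge0.
  by rewrite pmulr_rge0.
apply: (@le_trans _ _ ((c ^+ 2)^-1 * (6 * rgap (cnt n)))).
  by rewrite ler_wpM2l// invr_ge0 sqr_ge0.
have hb : 6 / c ^+ 2 <= (Num.bound (6 / c ^+ 2))%:R.
  by apply/ltW/archi_boundP; rewrite divr_ge0 ?sqr_ge0.
by rewrite mulrA ler_wpM2r// mulrC.
Qed.

Hypothesis weighted_cvg : forall N : nat, cvgn (fun n =>
  \sum_(i < n)
    ((weight i / wsum i) ^+ 2 <= N%:R * rgap (cnt i))%R%:R *
    (weight i / wsum i) * ((kept i)%:R - (1 - F (avg i)))).

Lemma wsum_asymp e : 0 < e -> exists m, forall n, (m <= n)%N -> kept n ->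
  `|n.+2%:R / wsum n - 1| < e.
Proof.
move=> e0; have [N [n0 hN]] := weight_ratio_sqr.
pose u i : R := ((weight i / wsum i) ^+ 2 <= N%:R * rgap (cnt i))%R%:R *
  (weight i / wsum i) * ((kept i)%:R - (1 - F (avg i))).
(* The term [u i] without its cut-off, with [weight i] multiplied into the bracket. *)
pose v i : R := ((kept i)%:R * weight i - 1) / wsum i.
have uv i : (n0 <= i)%N -> u i = v i.
  move=> ni; rewrite /u /v hN// mul1r; have := weight_gt0 i.
  have -> : 1 - F (avg i) = (weight i)^-1 by rewrite /weight invrK.
  move: (weight i) => w w0; have := wsum_gt0 i; move: (wsum i) => s sgt0.
  by field; rewrite !gt_eqF.
have cv := @cvgn_sum_tail R u v n0 uv (@weighted_cvg N).
have wub A : exists n, A <= wsum n.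
  have [n hn] := cnt_unbounded (Num.bound `|A|); exists n.
  rewrite (le_trans _ (wsum_ge_cnt n))// (le_trans (ler_norm _))//.
  by rewrite (le_trans (ltW (archi_boundP _)))// ler_nat.
have e2 : 0 < e / 2 by rewrite divr_gt0.
have [m hm] := @kronecker R wsum (fun i => (kept i)%:R * weight i - 1)
  wsum_gt0 wsum_leS wub cv _ e2.
have [p hp] := wub ((e / 2)^-1).
exists (maxn m p) => n; rewrite geq_max => /andP[mn pn] kn.
have s0 := wsum_gt0 n.
have := hm n mn; rewrite sumrB sum_kept_weight wsumS kn mul1r addrK.
rewrite big_const_ord iter_addr_0 => h1.
have h2 : (wsum n)^-1 <= e / 2.
  rewrite -[e / 2]invrK lef_pV2 ?posrE ?invr_gt0// (le_trans hp)//.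
  have nd i j : (i <= j)%N -> wsum i <= wsum j.
    move=> /subnKC <-; elim: (j - i)%N => [|k IH]; first by rewrite addn0.
    by rewrite addnS (le_trans IH)// wsum_leS.
  exact: nd.
(* The retention time is [n.+2] while the martingale has made [n.+1] steps; the difference costs
   [(wsum n)^-1], which tends to 0. *)
have -> : n.+2%:R / wsum n - 1 =
    (wsum n)^-1 - (wsum n - n.+1%:R) / wsum n.
  by rewrite -natr1; field; rewrite gt_eqF.
rewrite (le_lt_trans (ler_normB _ _))// ger0_norm ?invr_ge0 ?(ltW s0)//.
by move: h1 h2; rewrite [_ *+ _]/(n.+1%:R); lra.
Qed.

Theorem ret_ratio_cvg : ret_ratio F 1 y k @[k --> \oo] --> 1%:E.
Proof.
apply/fine_cvgP; split.
  by exists 2%N => // k /= /ret_ratio_kept[p [_ _ ->]].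
apply/cvgrPdist_lt => e e0; have [m hm] := wsum_asymp e0.
exists (maxn 2 m.+2) => // k /=; rewrite geq_max => /andP[k2 km].
have [p [kp pk ->]] := ret_ratio_kept k2.
rewrite /= distrC; apply: hm => //.
by have := leq_trans km pk; rewrite !ltnS.
Qed.

End ratio.
End divergence.
End record_process.

(** * Almost sure properties of the retained values *)

Lemma absolutely_continuous_continuous (R : realType) (F : R -> R) :
  absolutely_continuous `]-oo, +oo[ F -> continuous F.
Proof.
move=> F_ac x; apply/cvgrPdist_lt => e e0; have [t t0 ht] := F_ac e e0.
have near_le u v : u <= v -> v - u < t -> `|F v - F u| < e.
  move=> uv vut; have := ht 1%N (fun=> u) (fun=> v).
  rewrite !big_ord1; apply => //.
  by move=> i j _ _ _; rewrite !ord1.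
exists t => // y /=; have [xy|yx] := leP x y.
  by rewrite distrC ger0_norm ?subr_ge0// => h; rewrite distrC near_le.
by rewrite ger0_norm ?subr_ge0 1?ltW// => h; rewrite near_le// ltW.
Qed.

Section retained_process.
Context d (Omega : measurableType d) (R : realType) (P : probability Omega R).
Variables (X : nat -> {RV P >-> R}) (F : R -> R).
Hypothesis X_iid : iid_with_cdf X F.
Hypothesis F_lt1 : forall x, F x < 1.

Let F0 : forall y, 0 <= F y. Proof. exact: F_ge0 X_iid. Qed.

Definition sample w i := X i w.
Definition avgX n w := avg F (sample w) n.
Definition wsumX n w := wsum F (sample w) n.
Definition cntX n w := cnt F (sample w) n.
Definition weightX n w := weight F (sample w) n.

Lemma measurable_weight : measurable_fun setT (fun y : R => (1 - F y)^-1).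
Proof.
apply: nondecreasing_measurable => // y z yz.
rewrite lef_pV2 ?posrE ?subr_gt0// lerB//; exact: F_nd X_iid _ _ yz.
Qed.

Lemma adapted_state n :
  [/\ adapted X n (avgX n), adapted X n (wsumX n) & adapted X n (cntX n)].
Proof.
elim: n => [|n [aavg awsum acnt]].
  split.
  - exact: (@adapted_X _ _ _ P X 0 0).
  - apply: (measurableT_comp measurable_weight).
    exact: (@adapted_X _ _ _ P X 0 0).
  - exact: measurable_cst.
have aX : adapted X n.+1 (X n.+1) by exact: (@adapted_X _ _ _ P X n.+1 n.+1).
have {}aavg := adaptedS (leqnSn n) aavg.
have {}awsum := adaptedS (leqnSn n) awsum.
have {}acnt := adaptedS (leqnSn n) acnt.
have akept : adapted X n.+1 (fun w => kept F (sample w) n).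
  exact: measurable_fun_ltr.
have aavgS : adapted X n.+1 (avgX n.+1).
  have -> : avgX n.+1 = fun w => if kept F (sample w) n then
      avgX n w + (X n.+1 w - avgX n w) * ((fun k : nat => k.+1%:R^-1) (cntX n w))
      else avgX n w.
    by apply/funext => w; exact: avgS.
  apply: measurable_fun_ifT => //; apply: measurable_funD => //.
  apply: measurable_funM; first exact: measurable_funB.
  exact: (@measurableT_comp _ _ _ _ _ _ (fun k : nat => k.+1%:R^-1 : R)).
split => //.
- have -> : wsumX n.+1 = fun w => wsumX n w +
      (kept F (sample w) n)%:R * (fun y => (1 - F y)^-1) (avgX n.+1 w).
    by apply/funext => w; exact: wsumS.
  apply: measurable_funD => //; apply: measurable_funM.
    exact: measurable_bool_natr.
  exact: (measurableT_comp measurable_weight).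
- have -> : cntX n.+1 = fun w => if kept F (sample w) n then (cntX n w).+1 else cntX n w.
    apply/funext => w; rewrite /cntX cntS.
    by case: kept; rewrite ?addn1 ?addn0.
  apply: measurable_fun_ifT => //.
  exact: (@measurableT_comp _ _ _ _ _ _ S).
Qed.

Lemma avg_adapted n : adapted X n (avgX n).
Proof. by have [] := adapted_state n. Qed.

Lemma cnt_adapted (psi : nat -> R) n : adapted X n (fun w => psi (cntX n w)).
Proof.
have [_ _ h] := adapted_state n.
exact: (@measurableT_comp _ _ _ _ _ _ psi).
Qed.

Lemma weight_ratio_adapted n : adapted X n (fun w => weightX n w / wsumX n w).
Proof.
have [aavg awsum _] := adapted_state n.
apply: measurable_funM; first exact: (measurableT_comp measurable_weight).
have -> : (fun w => (wsumX n w)^-1) = (fun w => wsumX n w `^ (-1)).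
  by apply/funext => w; rewrite powR_inv1// ltW// wsum_gt0.
by apply: (@measurableT_comp _ _ _ _ _ _ (@powR R ^~ (-1))) => //; exact: measurable_powR.
Qed.

Lemma exceed_avg n w : exceed X avgX n w = (kept F (sample w) n)%:R.
Proof. by []. Qed.

Lemma bounded_cnt (psi : nat -> R) n M : (forall k, `|psi k| <= M) ->
  bounded_measurable (fun w => psi (cntX n w)).
Proof.
move=> h; split; last by exists M => w.
exact: (adapted_measurable (@cnt_adapted psi n)).
Qed.

Lemma sum_expect_telescope (psi : nat -> R) (M : R) n :
  (forall k, `|psi k| <= M) -> (forall k, 0 <= psi k) ->
  \sum_(i < n) \int[P]_w ((psi (cntX i w) - psi (cntX i w).+1) *
     exceed X avgX i w) <= psi 1%N.
Proof.
move=> hM psi0.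
have bg i : bounded_measurable (fun w => psi (cntX i w) - psi (cntX i w).+1).
  by apply: (@bounded_cnt (fun k => psi k - psi k.+1) i (M + M)) => k;
    rewrite (le_trans (ler_normB _ _))// lerD.
have be i : bounded_measurable (exceed X avgX i).
  exact: (exceed_bm avg_adapted).
rewrite -(@expect_sum _ _ _ P n (fun i w => (psi (cntX i w) - psi (cntX i w).+1) *
     exceed X avgX i w)); last by move=> i; exact: bounded_measurableM.
rewrite -[leRHS](expect_cst P); apply: expect_le.
- apply: (@bounded_measurable_sum _ _ _ n (fun i w =>
    (psi (cntX i w) - psi (cntX i w).+1) * exceed X avgX i w)) => i.
  exact: bounded_measurableM.
- exact: bounded_measurable_cst.
move=> w; under eq_bigr do rewrite mulrC exceed_avg.
by rewrite sum_kept_telescope gerBl.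
Qed.

Lemma ae_exceed_cvg : {ae P, forall w, forall K : nat, cvgn (fun n =>
  \sum_(i < n) i.+2%:R^-1 * ((K%:R < sample w i.+1)%R%:R - (1 - F K%:R)))}.
Proof.
apply: ae_foralln => K.
pose c (i : nat) (w : Omega) : R := K%:R.
pose a (i : nat) (w : Omega) : R := i.+2%:R^-1.
have ac i : adapted X i (c i) by exact: measurable_cst.
apply: (@mart_cvg _ _ _ _ _ _ X_iid c ac a 1).
- by move=> i; exact: measurable_cst.
- by move=> i; exact: bounded_measurable_cst.
(* The squares of the coefficients have a telescoping majorant with sum at most 1. *)
move=> n; apply: (@le_trans _ _ (\sum_(i < n) (i.+1%:R^-1 - i.+2%:R^-1))).
  apply: ler_sum => i _; rewrite -[leRHS](expect_cst P).
  apply: expect_le.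
  - apply: bounded_measurableM; last exact: exceed_bm.
    exact: (bounded_measurable_cst Omega (i.+2%:R^-1 ^+ 2)).
  - exact: bounded_measurable_cst.
  move=> w; apply: (@le_trans _ _ (a i w ^+ 2)).
    by rewrite ler_piMr ?sqr_ge0// /exceed; case: (_ < _).
  rewrite /a; have n1 : 0 < i.+1%:R :> R by rewrite ltr0n.
  rewrite -[i.+2%:R]natr1; move: (i.+1%:R : R) n1 => z z0.
  have -> : z^-1 - (z + 1)^-1 = z^-1 * (z + 1)^-1.
    by field; rewrite !gt_eqF// addr_gt0.
  rewrite expr2 ler_wpM2r ?invr_ge0 ?addr_ge0 ?(ltW z0)//.
  by rewrite lef_pV2 ?posrE ?addr_gt0// lerDl.
rewrite -(big_mkord predT (fun i => i.+1%:R^-1 - i.+2%:R^-1 : R)).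
under eq_bigr do rewrite -opprB.
rewrite sumrN (@telescope_sumr _ 0 n (fun i => i.+1%:R^-1 : R))//.
by rewrite opprB invr1 gerBl invr_ge0.
Qed.

(** The cut-off is decided at time [i], so the coefficients stay predictable. Their squares are at
    most [N%:R * rgap (cntX i w)], and the sum of [rgap] over the retained values telescopes to at
    most 1, whence the second-moment bound [N%:R]. *)
Lemma ae_weighted_cvg : {ae P, forall w, forall N : nat, cvgn (fun n =>
  \sum_(i < n)
    ((weightX i w / wsumX i w) ^+ 2 <= N%:R * rgap (cntX i w))%R%:R *
    (weightX i w / wsumX i w) * ((kept F (sample w) i)%:R - (1 - F (avgX i w))))}.
Proof.
apply: ae_foralln => N.
pose b i w := (weightX i w / wsumX i w) ^+ 2 <= N%:R * rgap (cntX i w).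
pose a i w : R := (b i w)%:R * (weightX i w / wsumX i w).
have ar i := weight_ratio_adapted i.
have aa i : adapted X i (a i).
  apply: measurable_funM => //; last exact: ar.
  apply: measurable_bool_natr; apply: measurable_fun_ler.
    by apply: measurable_funX; exact: ar.
  apply: measurable_funM; first exact: measurable_cst.
  exact: cnt_adapted.
have r01 i w : 0 <= weightX i w / wsumX i w <= 1.
  have w0 := weight_gt0 (sample w) F0 F_lt1 i; have w1 := wsum_gt0 (sample w) F0 F_lt1 i.
  rewrite divr_ge0 ?(ltW w0) ?(ltW w1)//=.
  by rewrite ler_pdivrMr ?wsum_gt0// mul1r weight_le_wsum.
have ba i : bounded_measurable (a i).
  split; first exact: (adapted_measurable (aa i)).
  exists 1 => w; rewrite /a; have /andP[r0 r1] := r01 i w.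
  by case: (b i w); rewrite ?mul0r ?normr0// mul1r ger0_norm.
pose psi k : R := (Num.sqrt k%:R)^-1.
have psi0 k : 0 <= psi k by rewrite invr_ge0 sqrtr_ge0.
have psi1 k : `|psi k| <= 1.
  rewrite ger0_norm//; case: k => [|k]; first by rewrite /psi sqrtr0 invr0.
  by rewrite invf_le1 ?sqrtr_gt0 ?ltr0n// -[leLHS]sqrtr1 ler_sqrt ?ltr0n// ler1n.
have gE k : rgap k = psi k - psi k.+1 by [].
have g0 k : (0 < k)%N -> 0 <= rgap k :> R.
  move=> k0; have : 0 <= 6 * rgap k :> R.
    by rewrite (le_trans _ (rgap_ge k0))// invr_ge0 sqr_ge0.
  by rewrite pmulr_rge0.
have := @mart_cvg _ _ _ _ _ _ X_iid avgX avg_adapted a N%:R aa ba.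
apply => n.
have be i : bounded_measurable (exceed X avgX i).
  exact: (exceed_bm avg_adapted).
apply: (@le_trans _ _ (\sum_(i < n) N%:R *
    \int[P]_w ((psi (cntX i w) - psi (cntX i w).+1) * exceed X avgX i w))); last first.
  rewrite -mulr_sumr -[leRHS]mulr1 ler_wpM2l//.
  by rewrite (le_trans (sum_expect_telescope n psi1 psi0))// (le_trans (ler_norm _)).
apply: ler_sum => i _.
have bg' : bounded_measurable (fun w => psi (cntX i w) - psi (cntX i w).+1).
  by apply: (@bounded_cnt (fun k => psi k - psi k.+1) i (1 + 1)) => k;
    rewrite (le_trans (ler_normB _ _))// lerD.
rewrite -RintegralZl//; last exact/bounded_integrable/bounded_measurableM.
apply: expect_le.
- by apply: bounded_measurableM => //; exact: bounded_measurableX.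
- apply: bounded_measurableM; first exact: (bounded_measurable_cst Omega N%:R).
  exact: bounded_measurableM.
move=> w; rewrite mulrA ler_wpM2r ?ler0n// /a.
case E : (b i w); first by rewrite mul1r; exact: E.
by rewrite mul0r expr0n mulr_ge0// -gE g0// cnt_gt0.
Qed.

(** If the level is not below all values of [1 - F], continuity attains it at some [c], and the
    event lies in [c < X n], whose probability is exactly the level. Otherwise the event is
    empty. *)
Lemma survival_level n m u : continuous F -> 0 < u <= 1 ->
  (P [set w | (1 - F (X n w) < (1 - F m) * u)%R] <= ((1 - F m) * u)%:E)%E.
Proof.
move=> F_cont /andP[u0 u1].
have s0 : 0 < 1 - F m by rewrite subr_gt0.
have su : (1 - F m) * u <= 1 - F m by rewrite ler_piMr// ltW.
have [[y hy]|hN] := pselect (exists y, 1 - F y < (1 - F m) * u); last first.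
  have -> : [set w | 1 - F (X n w) < (1 - F m) * u] = set0.
    by apply/seteqP; split => w //= h; apply: hN; exists (X n w).
  by rewrite measure0 lee_fin mulr_ge0 ?ltW.
have my : m <= y.
  by rewrite leNgt; apply/negP => /ltW /(F_nd X_iid) ?; lra.
have [|c _ hc] := @IVT R F m y (1 - (1 - F m) * u) my
  (continuous_subspaceT F_cont).
  have Fmy := F_nd X_iid my.
  by rewrite (min_idPl Fmy) (max_idPr Fmy); apply/andP; split; lra.
rewrite -[X in (_ <= X%:E)%E](_ : 1 - F c = _); last by rewrite hc; lra.
rewrite -(P_gt X_iid n).
have mF := F_measurable X_iid.
have mX : measurable_fun setT (X n) by exact: measurable_funP.
apply: le_measure; rewrite ?inE.
- apply: measurable_bool_set; apply: measurable_fun_ltr => //.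
  by apply: measurable_funB => //; exact: measurableT_comp.
- by apply: measurable_bool_set; exact: measurable_fun_ltr.
- move=> w /=; rewrite !ltNge; apply: contra => /(F_nd X_iid).
  by rewrite hc; lra.
Qed.

Lemma gap_bounds (k : nat) : (0 < k)%N -> 0 < (gap k : R) <= 1.
Proof.
move=> k0; have k0' : 0 < k%:R :> R by rewrite ltr0n.
have k1 : k%:R^-1 <= 1 :> R by rewrite invf_le1// ler1n.
rewrite /gap subr_gt0 ltf_pV2 ?posrE ?ltr0n// ltr_nat leqnn/=.
by rewrite (le_trans _ k1)// gerBl.
Qed.

(** Given the past, [bad i] has probability at most [(1 - F (avgX i w)) * gap (cntX i w)]. The first
    factor is the conditional probability of a retention, so the expectation of this bound is that
    of [gap] times the retention indicator. Summed over all times it telescopes to at most 1, and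
    Borel-Cantelli applies. *)
Lemma ae_moderate : continuous F ->
  {ae P, forall w, exists i0, forall i, (i0 <= i)%N -> kept F (sample w) i ->
    (1 - F (avgX i w)) * gap (cntX i w) <= 1 - F (sample w i.+1)}.
Proof.
move=> F_cont.
pose s i w : R := (1 - F (avgX i w)) * gap (cntX i w).
pose psi (k : nat) : R := k%:R^-1.
have psi0 k : 0 <= psi k by rewrite invr_ge0.
have psi1 k : `|psi k| <= 1.
  rewrite ger0_norm//; case: k => [|k]; first by rewrite /psi invr0.
  by rewrite invf_le1 ?ltr0n// ler1n.
have mF := F_measurable X_iid.
have bt i : bounded_measurable (fun w => 1 - F (avgX i w)).
  exact: (tail_bm X_iid avg_adapted).
have bgap i : bounded_measurable (fun w => gap (cntX i w) : R).
  by apply: (@bounded_cnt (fun k => psi k - psi k.+1) i (1 + 1)) => k;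
    rewrite (le_trans (ler_normB _ _))// lerD.
have agap i : adapted X i (fun w => gap (cntX i w) : R).
  exact: (@cnt_adapted (fun k => gap k)).
have as_ i : adapted X i (s i).
  apply: measurable_funM; last exact: agap.
  exact: (tail_adapted X_iid avg_adapted).
have bs i : bounded_measurable (s i) by exact: bounded_measurableM.
have s0 i w : 0 <= s i w.
  have /andP[g0 _] := gap_bounds (cnt_gt0 F (sample w) i).
  by rewrite mulr_ge0 ?(ltW g0)// subr_ge0 ltW.
pose bad i := [set w | (1 - F (X i.+1 w) < s i w)%R].
have mbad i : measurable (bad i).
  apply: measurable_bool_set; apply: measurable_fun_ltr.
    by apply: measurable_funB => //; exact: measurableT_comp.
  exact: (adapted_measurable (@as_ i)).
have Pbad i : (P (bad i) <= (\int[P]_w (gap (cntX i w) * exceed X avgX i w))%:E)%E.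
  have -> : \int[P]_w (gap (cntX i w) * exceed X avgX i w) = \int[P]_w s i w.
    rewrite (expect_exceed X_iid (@agap i) (@avg_adapted i) (bgap i)).
    by apply: eq_Rintegral => w _; rewrite mulrC.
  have mb : measurable_fun setT (fun w => 1 - F (X i.+1 w) < s i w).
    apply: measurable_fun_ltr; last exact: (adapted_measurable (@as_ i)).
    by apply: measurable_funB => //; exact: measurableT_comp.
  rewrite /bad -(integral_bool P mb).
  pose f (z : Omega * R) : \bar R := ((1 - F z.2 < s i z.1)%R%:R)%:E.
  have mf : measurable_fun setT (f : past X i * R -> \bar R).
    apply/measurable_EFinP; apply: measurable_bool_natr.
    apply: measurable_fun_ltr; last exact: (measurableT_comp (@as_ i)).
    by apply: measurable_funB => //; exact: measurableT_comp.
  rewrite [leLHS](@integral_past_next _ _ _ _ _ X_iid.1 i f mf); last first.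
    by move=> z; rewrite lee_fin.
  rewrite /Rintegral fineK; last exact/integrable_fin_num/bounded_integrable.
  apply: ge0_le_integral => //.
  - by move=> w _; apply: integral_ge0 => y _; rewrite lee_fin.
  - have h : measurable_fun setT
        (fubini_F (distribution P (X i.+1)) (f : past X i * R -> \bar R)).
      by apply: measurable_fun_fubini_tonelli_F => // z; rewrite lee_fin.
    by move=> _ B mB; apply: (@past_measurable _ _ _ _ X i); exact: h.
  - by apply/measurable_EFinP; case: (bs i).
  move=> w _; rewrite /f /= integral_bool; last first.
    by apply: measurable_fun_ltr => //; apply: measurable_funB.
  apply: survival_level => //; apply: gap_bounds; exact: cnt_gt0.
have sumbad : (\sum_(0 <= i <oo) P (bad i) < +oo)%E.
  apply: (@le_lt_trans _ _ 1%:E); last exact: ltry.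
  apply: lime_le; first exact: is_cvg_nneseries.
  apply: nearW => n; rewrite big_mkord.
  apply: (@le_trans _ _ (\sum_(i < n)
      \int[P]_w ((psi (cntX i w) - psi (cntX i w).+1) * exceed X avgX i w))%:E).
    by rewrite -sumEFin; apply: lee_sum => i _; exact: Pbad.
  rewrite lee_fin (le_trans (sum_expect_telescope n psi1 psi0))//.
  by rewrite (le_trans (ler_norm _)).
have L0 : P.-negligible (lim_sup_set bad).
  apply/negligibleP; last exact: lim_sup_set_cvg0.
  apply: bigcapT_measurable => n; apply: bigcup_measurable => *; exact: mbad.
apply: negligibleS L0 => w /= nw n _.
apply: contrapT => h; apply: nw; exists n => i ni _.
by rewrite leNgt; apply/negP => b; apply: h; exists i.
Qed.

End retained_process.

(* The observation numbered i, for i >= 1, is [X i.-1]. *)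
Theorem theorem5p1 (R : realType) (d : measure_display)
    (Omega : measurableType d) (P : probability Omega R)
    (X : nat -> {RV P >-> R}) (F : R -> R) (alpha : R)
    (F_abs_cont : absolutely_continuous `]-oo, +oo[ F)
    (F_lt1 : forall x, F x < 1)
    (X_iid : iid_with_cdf X F)
    (alpha_gt0 : 0 < alpha)
    (F_G : stretched_exponential alpha F) :
  {ae P, forall w : Omega,
    ret_ratio F 1 (fun i => X i.-1 w) k @[k --> \oo] --> 1%:E}.
Proof.
have F_cont := absolutely_continuous_continuous F_abs_cont.
have h1 := ae_exceed_cvg X_iid.
have h2 := ae_moderate X_iid F_lt1 F_cont.
have h3 := ae_weighted_cvg X_iid F_lt1.
move: h1 h2 h3; apply: filterS3 => w h1 h2 h3.
apply: (@ret_ratio_cvg R F (sample X w) (F_ge0 X_iid) F_lt1 h1 _ h2 h3).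
exact: (survival_step alpha_gt0 F_lt1 F_G).
Qed.
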